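(* Let $L>0$, $\Omega:=(0,L)$, and $f\in \mathcal Y(\Omega)$. Assume that the following alternative holds for some $\alpha\in(0,1)$: for every $g\in\mathcal Y(\Omega)$ there is a unique classical solution $w\in\mathcal X^\alpha(\Omega)$ of $L_\Delta w=g$ in $\Omega$, $w=0$ on $\mathbb R\setminus\Omega$, and moreover $\|w\|_{\mathcal X^\alpha(\Omega)}\le C_0\|g\|_{\mathcal Y(\Omega)}$ for some constant $C_0>0$ depending only on $\Omega$. Let $u\in\mathbb H(\Omega)$ be the (unique weak) solution of $L_\Delta u=f$ in $\Omega$, $u=0$ on $\mathbb R\setminus\Omega$, and, for $h=\frac{L}{N+1}$ with $N\in\mathbb N$, let $u_h\in\mathcal V_h$ be its finite element approximation, that is, $\mathcal E_L(u_h,v)=\int_\Omega f(x)v(x)\,dx$ for all $v\in\mathcal V_h$. Then there are constants $h_0>0$, $C>0$, and $\beta\in(0,1)$ such that $$\|u-u_h\|_{\mathbb H(\Omega)}\le C\,\ell^{\beta}(h)\,\|f\|_{\mathcal Y(\Omega)}\qquad\text{for all } h\in(0,h_0).$$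
   Context: Modulus: $\ell(\rho):=|\ln(\min(0.1,\rho))|^{-1}$ for $\rho>0$, and $\ell^\beta(\rho):=(\ell(\rho))^\beta$. Operator: $L_\Delta u(x)=\int_{x-1}^{x+1}\frac{u(x)-u(y)}{|x-y|}\,dy-\int_{\mathbb R\setminus(x-1,x+1)}\frac{u(y)}{|x-y|}\,dy+\rho_1u(x)$, with $\rho_1:=2\ln 2+\psi(\tfrac12)-\gamma$, where $\psi=\Gamma'/\Gamma$ and $\gamma=-\Gamma'(1)$. A classical solution is a function for which the equation holds pointwise at every $x\in\Omega$. Spaces: let $d(x)=\operatorname{dist}(x,\partial\Omega)$ and $d(x,y)=\min(d(x),d(y))$. $\mathcal X^\alpha(\Omega)$ is the set of $u:\mathbb R\to\mathbb R$ with $u=0$ in $\mathbb R\setminus\Omega$ and $\|u\|_{\mathcal X^\alpha(\Omega)}<\infty$, where $$\|u\|_{\mathcal X^\alpha(\Omega)}:=\sup_{x,y\in\mathbb R,\,x\ne y}\frac{|u(x)-u(y)|}{\ell^\alpha(|x-y|)}+\sup_{x,y\in\Omega,\,x\neq y}\ell^{1+\alpha}(d(x,y))\frac{|u(x)-u(y)|}{\ell^{1+\alpha}(|x-y|)}.$$ $\mathcal Y(\Omega)$ is the set of $f:\Omega\to\mathbb R$ with $\|f\|_{\mathcal Y(\Omega)}:=\|f\|_{L^\infty(\Omega)}+\sup_{x,y\in\Omega,\,x\ne y}\ell^2(d(x,y))\frac{|f(x)-f(y)|}{\ell(|x-y|)}<\infty$. $\mathbb H(\Omega):=\{u\in L^2(\Omega):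 \|u\|_{\mathbb H(\Omega)}<\infty,\ u=0\text{ on }\mathbb R\setminus\Omega\}$ with $\|u\|_{\mathbb H(\Omega)}^2:=\int_{\mathbb R}\int_{x-1}^{x+1}\frac{|u(x)-u(y)|^2}{|x-y|}\,dy\,dx$. Bilinear form, for $u,v\in\mathbb H(\Omega)$: $$\mathcal E_L(u,v)=\frac12\int_{\mathbb R}\int_{x-1}^{x+1}\frac{(u(x)-u(y))(v(x)-v(y))}{|x-y|}\,dy\,dx-\iint_{|x-y|\ge1}\frac{u(x)v(y)}{|x-y|}\,dx\,dy+\rho_1\int_{\mathbb R}uv\,dx.$$ For $f\in L^2(\Omega)$, $u\in\mathbb H(\Omega)$ is a weak solution of $L_\Delta u=f$ in $\Omega$, $u=0$ on $\mathbb R\setminus\Omega$, if $\mathcal E_L(u,v)=\int_\Omega fv\,dx$ for all $v\in\mathbb H(\Omega)$. Discretization: for $N\in\mathbb N$ ($N\geq 1$), $h=\frac L{N+1}$, $x_i=ih$, $\Omega_i=(x_i,x_{i+1})$ for $i=0,\dots,N$, and $\mathcal V_h$ is the space of functions $v:\mathbb R\to\mathbb R$ that are continuous on $\Omega$, vanish on $\mathbb R\setminus\Omega$, and whose restriction to each $\Omega_i$ is a polynomial of degree at most one (jumps at $0$ and $L$ are allowed). The parameter $h$ ranges over the values $L/(N+1)$. *)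

(* Defs.v *)
From HB Require Import structures.
From mathcomp Require Import all_boot all_order all_algebra.
From mathcomp Require Import all_classical all_reals all_analysis.

Set Implicit Arguments.
Unset Strict Implicit.
Unset Printing Implicit Defensive.
Import Order.TTheory GRing.Theory Num.Theory.
Import numFieldNormedType.Exports.

Local Open Scope classical_set_scope.
Local Open Scope ring_scope.

Section LogLaplacian.
Context {R : realType}.
Implicit Types (Omega : set R) (u v w f g : R -> R).

Local Notation mu := (@lebesgue_measure R).

Definition ell (rho : R) : R := `|ln (Num.min (10%:R^-1) rho)|^-1.

Definition ellp (beta rho : R) : R := ell rho `^ beta.

Definition Gamma (x : R) : R :=
  \int[mu]_(t in `]0, +oo[) (t `^ (x - 1) * expR (- t)).

Definition digamma (x : R) : R := derive1 Gamma x / Gamma x.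

Definition euler_gamma : R := - derive1 Gamma 1.

Definition rho1 : R := 2 * ln 2 + digamma (2^-1) - euler_gamma.

(* Both integrals are Lebesgue integrals.  In the first one the integrand at
   y = x is 0 / 0 = 0. *)
Definition LDelta u (x : R) : R :=
  \int[mu]_(y in `]x - 1, x + 1[) ((u x - u y) / `|x - y|)
  - \int[mu]_(y in ~` `]x - 1, x + 1[) (u y / `|x - y|)
  + rho1 * u x.

(* Since Rintegral has a default value on non-integrable functions, the
   pointwise validity of the equation includes the convergence of the two
   integrals; it is automatic when u \in X^alpha with 0 < alpha. *)
Definition classical_solution Omega g u : Prop :=
  forall x, Omega x ->
    [/\ mu.-integrable `]x - 1, x + 1[
          (fun y => ((u x - u y) / `|x - y|)%:E),
        mu.-integrable (~` `]x - 1, x + 1[) (fun y => (u y / `|x - y|)%:E)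
      & LDelta u x = g x].

Definition vanishes_outside Omega u : Prop := forall x, ~ Omega x -> u x = 0.

Definition boundary (A : set R) : set R := closure A `\` interior A.

Definition bdist Omega (x : R) : R := inf [set `|x - z| | z in boundary Omega].

Definition bdist2 Omega (x y : R) : R := Num.min (bdist Omega x) (bdist Omega y).

Definition normX Omega (alpha : R) u : \bar R :=
  (ereal_sup [set (`|u p.1 - u p.2| / ellp alpha `|p.1 - p.2|)%:E
               | p in [set p : R * R | p.1 <> p.2]]
   + ereal_sup [set (ellp (1 + alpha) (bdist2 Omega p.1 p.2) *
                     (`|u p.1 - u p.2| / ellp (1 + alpha) `|p.1 - p.2|))%:E
               | p in [set p : R * R |
                        [/\ Omega p.1, Omega p.2 & p.1 <> p.2]]])%E.

Definition spaceX Omega (alpha : R) u : Prop :=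
  vanishes_outside Omega u /\ (normX Omega alpha u < +oo)%E.

(* A function Omega -> R is represented by a function R -> R of which only the
   values on Omega matter; f \_ Omega is its extension by zero. *)
Definition normY Omega f : \bar R :=
  ('N[mu]_+oo[EFin \o (f \_ Omega)]
   + ereal_sup [set (ellp 2 (bdist2 Omega p.1 p.2) *
                     (`|f p.1 - f p.2| / ell `|p.1 - p.2|))%:E
               | p in [set p : R * R |
                        [/\ Omega p.1, Omega p.2 & p.1 <> p.2]]])%E.

Definition spaceY Omega f : Prop := (normY Omega f < +oo)%E.

Definition normH u : \bar R :=
  poweR (\int[mu]_x \int[mu]_(y in `](x - 1)%R, (x + 1)%R[)
           (`|u x - u y| ^+ 2 / `|x - y|)%:E)%E 2^-1.

(* Elements are functions, not classes modulo equality almost everywhere. *)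
Definition spaceH Omega u : Prop :=
  [/\ u \in Lfun mu 2%:E, (normH u < +oo)%E & vanishes_outside Omega u].

Definition EL u v : R :=
  2^-1 * fine (\int[mu]_x \int[mu]_(y in `](x - 1)%R, (x + 1)%R[)
                 ((u x - u y) * (v x - v y) / `|x - y|)%:E)%E
  - \int[(mu \x mu)%E]_(p in [set p : R * R | 1 <= `|p.1 - p.2|])
      (u p.1 * v p.2 / `|p.1 - p.2|)
  + rho1 * \int[mu]_x (u x * v x).

Definition weak_solution Omega f u : Prop :=
  spaceH Omega u /\
  forall v, spaceH Omega v -> EL u v = \int[mu]_(x in Omega) (f x * v x).

Definition spaceV (L : R) (N : nat) v : Prop :=
  let h := L / N.+1%:R in
  [/\ {in `]0, L[, continuous v},
      vanishes_outside `]0, L[ v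
    & forall i : nat, (i <= N)%N ->
        exists2 p : {poly R}, (size p <= 2)%N &
          forall x, x \in `](i%:R * h), (i.+1%:R * h)[ -> v x = p.[x]].

Definition fe_solution (L : R) (N : nat) f uh : Prop :=
  spaceV L N uh /\
  forall v, spaceV L N v -> EL uh v = \int[mu]_(x in `]0, L[) (f x * v x).

End LogLaplacian.

Arguments rho1 : clear implicits.
Arguments euler_gamma : clear implicits.

(* Main.v *)
Require Import Defs.
From HB Require Import structures.
From mathcomp Require Import all_boot all_order all_algebra.
From mathcomp Require Import all_classical all_reals all_analysis.
From mathcomp Require Import measurable_realfun ess_sup_inf ring lra.
Import Order.TTheory GRing.Theory Num.Theory.
Import numFieldNormedType.Exports.
Local Open Scope classical_set_scope.
Local Open Scope ring_scope.

(* The form E_L is symmetric, and it is coercive on H up to a multiple of the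
   squared L^2 norm.

   A function w of X^alpha-norm M satisfies, for |x - y| < 1,
     |w x - w y| / |x - y| <= M (D x + D y) kappa(x - y),
   where kappa(t) = ell^(1+alpha)(|t|) / |t| is integrable and the weight
   D = ell(d/2)^(-2) is square integrable.  By Fubini, w belongs to H and a
   classical solution is tested against any element of H.  The piecewise linear
   interpolant I w satisfies |w - I w| <= M ell^(1+alpha)(h) D, and therefore
   |w - I w|_H^2 <= C M^2 ell^alpha(h).

   Let e in H be orthogonal to V_h.  If k is an even Lipschitz kernel with
   0 <= k(t) <= 1/|t| supported in |t| <= 1, expanding the double integral of
   k(x - y) (e x - e y)^2 gives
     (int k) |e|_2^2 <= |e|_H^2 / 2 + int (k * e) e.
   The convolution k * e is Lipschitz, hence in Y, with norm controlled by
   |e|_2; solving the equation with right-hand side k * e and interpolating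
   its solution bounds the last integral by a small multiple of |e|_2^2 plus a
   multiple of |e|_H^2.  As int k can be chosen arbitrarily large, |e|_2 is a
   small multiple of |e|_H as soon as h is small, and this absorbs the defect
   of coercivity (Schatz's argument, without compactness).

   For e = u - u_h and w the classical solution for f, both u and w solve the
   weak problem, so that E_L(e, e) = E_L(e, w - I w). *)

(** The weight can be chosen independently of alpha. The X^alpha norm costs ell^-(1+alpha) of the
    boundary distance, which is at most ell^-2 since 1 + alpha <= 2, and D^2 is then a fourth power
    of a logarithm, hence integrable.

    The rate comes from splitting the energy of w - I w at |x - y| = h. Distant pairs would even
    give ell^(1+alpha)(h). For close pairs one of the two increments of w tames the kernel, and the
    other yields only M ell^alpha(h). After the square root this is beta = alpha / 2.

    The non-integrability of 1/|t| at the origin replaces compactness: it is what allows int k to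
    exceed any multiple of the coercivity defect L + |rho1|. The Lipschitz constant of k then blows
    up, but it is fixed before h and is beaten by ell^alpha(h).

    The weak solution u is never shown to lie in X^alpha or to equal w. Only the equality of the
    functionals E_L(u, .) and E_L(w, .) on H enters. *)

Set Implicit Arguments.
Unset Strict Implicit.
Unset Printing Implicit Defensive.

(** * The logarithmic modulus *)

Section LogModulus.
Context {R : realType}.
Implicit Types r s t h : R.

(** The reciprocal of [ell], a logarithm that is at least 1 and blows up at 0. Most estimates are
    inequalities between values of it. *)
Definition ellV (r : R) : R := `|ln (Num.min (10%:R^-1) r)|.

Lemma ell_ellV r : ell r = (ellV r)^-1. Proof. by []. Qed.

Lemma min10_gt0 r : 0 < r -> 0 < Num.min (10%:R^-1) r.
Proof. by move=> r0; rewrite lt_min r0 andbT invr_gt0. Qed.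

(** From exp(-1/2) >= 1 - 1/2, inverted and squared. It serves [ellV_ge1], which rests on e <=
    10. *)
Lemma expR1_le4 : expR 1 <= 4 :> R.
Proof.
have h := @expR_ge1Dx R (- 2^-1).
have e2 : expR (2^-1 : R) <= 2.
  have p : 0 < expR (2^-1 : R) by exact: expR_gt0.
  rewrite -(ler_pM2l (expR_gt0 (- 2^-1 : R))) expRN mulVf ?gt_eqF//.
  rewrite -expRN; lra.
have -> : (1 : R) = 2^-1 + 2^-1 by lra.
rewrite expRD; have := expR_gt0 (2^-1 : R); nra.
Qed.

Lemma ellV_ln r : 0 < r -> ellV r = - ln (Num.min (10%:R^-1) r).
Proof.
move=> r0; rewrite /ellV ler0_norm// ln_le0//.
by rewrite ge_min; apply/orP; left; rewrite invf_le1 // ler1n.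
Qed.

Lemma ellV_ge1 r : 0 < r -> 1 <= ellV r.
Proof.
move=> r0; rewrite ellV_ln// lerNr.
have m0 := min10_gt0 r0.
rewrite -ler_expR lnK ?posrE// expRN.
have h : Num.min (10%:R^-1) r <= 10^-1 by rewrite ge_min lexx.
apply: (le_trans h); rewrite lef_pV2 ?posrE ?expR_gt0//.
by have := expR1_le4; lra.
Qed.

Lemma ellV_gt0 r : 0 < r -> 0 < ellV r.
Proof. by move=> /ellV_ge1; apply: lt_le_trans. Qed.

Lemma ellV_anti r s : 0 < r -> r <= s -> ellV s <= ellV r.
Proof.
move=> r0 rs; have s0 := lt_le_trans r0 rs.
rewrite !ellV_ln// lerN2 ler_ln ?posrE ?min10_gt0//.
by rewrite le_min ge_min lexx /= ge_min rs orbT.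
Qed.

Lemma ellV_small r : 0 < r -> r <= 10^-1 -> ellV r = - ln r.
Proof. by move=> r0 r1; rewrite ellV_ln// min_r. Qed.

Lemma ln1D_le s : 0 < s -> 1 + ln s <= s.
Proof. by move=> s0; have := expR_ge1Dx (ln s); rewrite lnK ?posrE. Qed.

(** With s = h / t one has [ellV t = ellV h + ln s], and ln s <= s - 1 <= (s - 1) * [ellV h].
    Equivalently ell(t) / ell(h) >= t / h: the modulus dominates linear scaling. *)
Lemma ellV_scale t h : 0 < t -> t <= h -> h <= 10^-1 -> ellV t <= (h / t) * ellV h.
Proof.
move=> t0 th h1; have h0 := lt_le_trans t0 th.
have Lh := ellV_ge1 h0.
have -> : ellV t = ellV h + ln (h / t).
  by rewrite !ellV_small ?(le_trans th)// ln_div ?posrE//; ring.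
have s1 : 1 <= h / t by rewrite ler_pdivlMr// mul1r.
have := ln1D_le (divr_gt0 h0 t0).
have l0 : 0 <= ln (h / t) by apply: ln_ge0.
set s := h / t in s1 l0 *; set l := ln s in l0 *; nra.
Qed.

Lemma ellV_half r : 0 < r -> ellV (r / 2) <= 2 * ellV r.
Proof.
move=> r0; have L1 := ellV_ge1 r0.
have r20 : 0 < r / 2 by lra.
suff : ellV (r / 2) <= ellV r + 1 by lra.
have l2 : ln (2 : R) <= 1 by have := @ln1D_le 2; lra.
suff : ellV (r / 2) <= ellV r + ln 2 by lra.
have m0 := min10_gt0 r0; have m20 := min10_gt0 r20.
rewrite !ellV_ln// -[leRHS]opprK lerN2 opprD opprK -ln_div ?posrE//.
rewrite ler_ln ?posrE ?divr_gt0//.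
case: (ltP (10^-1) (r / 2)) => c; first by rewrite !minElt; case: ifP; lra.
by rewrite !minElt; case: ifP; lra.
Qed.

(** For l = [ellV r] the minimum is exp(-l), and l / 6 <= exp(l / 6) is raised to the power 6. Six
    is 4 + 2: the square of the boundary weight times the reciprocal of [ellp a] with a <= 2, as
    combined in [ellV4_le]. *)
Lemma ellV_pow6 r : 0 < r -> ellV r ^+ 6 * Num.min (10^-1) r <= 6 ^+ 6.
Proof.
move=> r0; have m0 := min10_gt0 r0; have L1 := ellV_gt0 r0.
set m := Num.min _ _ in m0 *.
have mE : m = expR (- ellV r) by rewrite ellV_ln// opprK lnK ?posrE.
rewrite mE expRN ler_pdivrMr ?expR_gt0//.
have -> : expR (ellV r) = expR (ellV r / 6) ^+ 6.
  by rewrite -expRM_natr; congr expR; field.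
rewrite -exprMn.
apply: lerXn2r; rewrite ?nnegrE ?mulr_ge0 ?expR_ge0 ?(ltW L1)//.
have := expR_ge1Dx (ellV r / 6); lra.
Qed.

End LogModulus.

(** * Integrability of the logarithmic kernel at the origin *)

Section Logker.
Context {R : realType}.
Local Notation mu := (@lebesgue_measure R).

Lemma measurable_invr_norm : measurable_fun setT (fun x : R => `|x|^-1).
Proof.
rewrite (_ : (fun x => _) = (fun x : R => `|x| `^ (-1))).
  apply: (@measurableT_comp _ _ _ _ _ _ (fun x : R => x `^ (-1))) => //.
by apply/funext => x; rewrite powR_inv1.
Qed.

Lemma measurable_ellV : measurable_fun setT (@ellV R).
Proof.
apply: measurableT_comp; first exact: normr_measurable.
apply: measurableT_comp => //.
by apply: measurable_minr.
Qed.

Lemma measurable_ellp (a : R) : measurable_fun setT (@ellp R a).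
Proof.
rewrite /ellp.
apply: (@measurableT_comp _ _ _ _ _ _ (fun x : R => x `^ a)) => //.
apply: (@measurableT_comp _ _ _ _ _ _ (fun x : R => `|x|^-1)).
  exact: measurable_invr_norm.
by apply: measurableT_comp => //; exact: measurable_minr.
Qed.

(** The kernel kappa of the overview, cut off at |t| = 1. Its value at t = 0 is 0 by the convention
    for division by zero. *)
Definition logker (a : R) (t : R) : R :=
  if `|t| < 1 then ellp a `|t| / `|t| else 0.

Lemma measurable_logker a : measurable_fun setT (logker a).
Proof.
apply: measurable_fun_ifT => //.
  by apply: measurable_fun_ltr.
apply: measurable_funM; last exact: measurable_invr_norm.
by apply: measurableT_comp; first exact: measurable_ellp.
Qed.

Lemma ell_gt0 (r : R) : 0 < r -> 0 < ell r.
Proof. by move=> r0; rewrite ell_ellV invr_gt0 ellV_gt0. Qed.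

Lemma ell_le1 (r : R) : 0 < r -> ell r <= 1.
Proof. by move=> r0; rewrite ell_ellV invf_le1 ?ellV_gt0// ellV_ge1. Qed.

Lemma logker_ge0 a t : 0 <= logker a t.
Proof. by rewrite /logker; case: ifP => // _; rewrite mulr_ge0// powR_ge0. Qed.

Lemma logkerN a t : logker a (- t) = logker a t.
Proof. by rewrite /logker normrN. Qed.

Lemma itv_oc_bigcup (b : R) : `]0, b]%classic = \bigcup_n `[n.+1%:R^-1, b]%classic.
Proof.
apply/seteqP; split => x /=.
  rewrite in_itv/= => /andP[x0 xb].
  exists (Num.truncn x^-1) => //=; rewrite in_itv/= xb andbT.
  rewrite -[leRHS]invrK lef_pV2 ?posrE ?invr_gt0//.
  by apply: ltW; exact: truncnS_gt.
by move=> [n _] /=; rewrite !in_itv/= => /andP[h ->]; rewrite andbT (lt_le_trans _ h).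
Qed.

(* On (0, 1/10), -(- ln r)^(1 - a) / (1 - a) is an antiderivative of ell^a(r) / r. *)
Lemma logker_near0 (a : R) : 1 < a ->
  (\int[mu]_(t in `]0%R, (10^-1)%R]) (ellp a t / t)%:E < +oo)%E.
Proof.
move=> a1; set b : R := 10^-1.
pose F (r : R) := (a - 1)^-1 * ((- ln r) `^ (1 - a)).
have b0 : 0 < b by rewrite invr_gt0.
have lnp x : 0 < x -> x <= b -> 0 < - ln x.
  by move=> x0 xb; rewrite -ellV_small// ellV_gt0.
have ellE x : 0 < x -> x <= b -> ellp a x / x = (- ln x) `^ (- a) / x.
  move=> x0 xb; congr (_ / _); rewrite /ellp ell_ellV ellV_small//.
  by rewrite -powR_inv1 ?(ltW (lnp _ _ _))// -powRrM mulN1r.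
have dF x : 0 < x -> x <= b -> is_derive x 1 F ((- ln x) `^ (- a) / x).
  move=> x0 xb.
  have d1 : is_derive x 1 (fun r : R => - ln r) (- x^-1).
    by apply: is_deriveN; exact: is_derive1_ln.
  have d2 := is_derive1_powR (1 - a) (lnp _ x0 xb).
  have d3 := @is_derive1_comp _ (fun y => y `^ (1 - a)) (fun r : R => - ln r) _ _ _ d2 d1.
  have d4 := is_deriveZ (a - 1)^-1 d3.
  apply: (is_derive_eq d4).
  rewrite /= /GRing.scale /= (_ : 1 - a - 1 = - a); last by ring.
  have xn : x != 0 by rewrite gt_eqF.
  have an : a - 1 != 0 by rewrite gt_eqF// subr_gt0.
  by field; rewrite ?xn ?an.
(* [F] is nonnegative, so F b - F e <= F b is a bound that does not depend on the cutoff e. *)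
have fin e : 0 < e -> e < b -> (\int[mu]_(t in `[e, b]) (ellp a t / t)%:E <= (F b)%:E)%E.
  move=> e0 eb.
  have inb x : x \in `[e, b] -> 0 < x /\ x <= b.
    by rewrite in_itv/= => /andP[h ->]; split => //; exact: lt_le_trans h.
  have cf x : x \in `[e, b] -> {for x, continuous (fun x => (- ln x) `^ (- a) / x)}.
    move=> /inb[x0 xb]; apply: continuousM.
      apply: (@continuous_comp _ _ _ (fun x : R => - ln x) (fun y => y `^ (- a))).
        by apply: continuousN; exact: continuous_ln.
      apply/differentiable_continuous; rewrite -derivable1_diffP.
      by apply: derivable_powR; rewrite in_itv/= andbT lnp.
    by apply: continuousV => //; rewrite gt_eqF.
  have -> : (\int[mu]_(t in `[e, b]) (ellp a t / t)%:E =
      \int[mu]_(t in `[e, b]) ((- ln t) `^ (- a) / t)%:E)%E.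
    by apply: eq_integral => x; rewrite inE/= => /inb[x0 xb]; rewrite ellE.
  rewrite (@continuous_FTC2 _ (fun x => (- ln x) `^ (- a) / x) F)//.
  - rewrite -EFinB lee_fin gerBl /F mulr_ge0 ?powR_ge0// invr_ge0; lra.
  - apply: continuous_in_subspaceT => x /set_mem xe; exact: cf.
  - have dc x : x \in `[e, b] -> derivable F x 1.
      by move=> /inb[x0 xb]; have [] := dF _ x0 xb.
    have cF x : x \in `[e, b] -> F @ x --> F x.
      move=> /dc d; apply/differentiable_continuous; by rewrite -derivable1_diffP.
    split.
    + move=> x; rewrite in_itv/= => /andP[h1 h2]; apply: dc.
      by rewrite in_itv/= !ltW.
    + by apply: cvg_at_right_filter; apply: cF; rewrite in_itv/= lexx ltW.
    + by apply: cvg_at_left_filter; apply: cF; rewrite in_itv/= lexx ltW.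
  - move=> x; rewrite in_itv/= => /andP[h1 h2]; rewrite derive1E.
    by have [_ ->] := dF x (lt_trans e0 h1) (ltW h2).
(* Monotone convergence along the intervals [1/(n+1), b] carries the uniform bound to ]0, b]. *)
rewrite itv_oc_bigcup.
have mf n : measurable_fun `[n.+1%:R^-1, b] (fun t => (ellp a t / t)%:E).
  apply/measurable_EFinP.
  apply: (@eq_measurable_fun _ _ _ _ _ (fun t => ellp a t * `|t|^-1)).
    move=> x; rewrite inE/= in_itv/= => /andP[h _]; rewrite ger0_norm//.
    by rewrite (le_trans _ h).
  apply: measurable_funTS; apply: measurable_funM; last exact: measurable_invr_norm.
  exact: measurable_ellp.
have nd : nondecreasing_seq (fun n => `[n.+1%:R^-1, b]%classic).
  move=> n m nm; apply/subsetPset => x /=; rewrite !in_itv/= => /andP[h ->].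
  by rewrite andbT (le_trans _ h)// lef_pV2 ?posrE// ler_nat.
have H : (\int[mu]_(x in `[(i.+1%:R^-1)%R, b]) (ellp a x / x)%:E)%E @[i --> \oo] -->
  (\int[mu]_(x in \bigcup_i `[(i.+1%:R^-1)%R, b]%classic) (ellp a x / x)%:E)%E.
  apply: ge0_nondecreasing_set_cvg_integral => // n x /=; rewrite in_itv/= => /andP[h _].
  by rewrite lee_fin mulr_ge0 ?powR_ge0// invr_ge0 (le_trans _ h).
apply: (@le_lt_trans _ _ (F b)%:E); last by rewrite ltry.
rewrite -(cvg_lim _ H)//.
apply: lime_le; first by apply/cvg_ex; eexists; exact: H.
near=> n; apply: fin => //.
near: n; exists 10%N => // n /= n10.
by rewrite /b ltf_pV2 ?posrE// ltr_nat.
Unshelve. all: by end_near. Qed.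
End Logker.

(** * Lebesgue integrals over products *)

Section Measure.
Context {R : realType}.
Local Notation mu := (@lebesgue_measure R).
Local Notation mu2 := (mu \x mu)%E.

Lemma measurable_subl (c : R) : measurable_fun setT (fun y : R => c - y).
Proof. by apply: measurable_funB. Qed.

(** Lebesgue measure is determined by its values on half-open intervals, and the reflection turns
    ]a, b] into [c - b, c - a[, of the same length. *)
Lemma lebesgue_measure_subl (c : R) (A : set R) : measurable A ->
  pushforward mu (fun y : measurableTypeR R => (c - y : measurableTypeR R)) A = mu A.
Proof.
move=> mA; apply/esym.
apply: (@lebesgue_measure_unique R
  (pushforward mu (fun y : measurableTypeR R => (c - y : measurableTypeR R)))) => //=.
  exact: measurable_subl.
move=> ? _ [[a b]] _ <-.
rewrite /pushforward.
rewrite (_ : _ @^-1` _ = `[c - b, c - a[%classic); last first.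
  by apply/seteqP; split => x /=; rewrite !in_itv/= => /andP[? ?]; lra.
rewrite /= !lebesgue_measure_itv/= !lte_fin ltrD2l ltrN2.
by case: ifP => // _; rewrite -!EFinB; congr EFin; ring.
Qed.

Lemma ge0_integral_subl (c : R) (f : R -> \bar R) :
  measurable_fun setT f -> (forall x, 0 <= f x)%E ->
  (\int[mu]_y f (c - y)%R = \int[mu]_y f y)%E.
Proof.
move=> mf f0.
transitivity (\int[pushforward mu (fun y : measurableTypeR R => (c - y)%R : measurableTypeR R)]_y f y)%E.
  rewrite ge0_integral_pushforward//=.
  exact: measurable_subl.
apply: eq_measure_integral => //=; first exact: measurable_subl.
by move=> ? A mA _; exact: lebesgue_measure_subl.
Qed.

Lemma measurable_sub12 : measurable_fun setT (fun p : R * R => p.1 - p.2).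
Proof. exact: measurable_funB. Qed.

Lemma integrable_ge0P d (T : measurableType d) (m : {measure set T -> \bar R}) (f : T -> R) :
  measurable_fun setT f -> (forall x, 0 <= f x) ->
  (\int[m]_x (f x)%:E < +oo)%E -> m.-integrable setT (EFin \o f).
Proof.
move=> mf f0 fi; apply/integrableP; split; first exact/measurable_EFinP.
rewrite (_ : (\int[m]_x _)%E = (\int[m]_x (f x)%:E)%E)//.
by apply: eq_integral => x _ /=; rewrite ger0_norm.
Qed.

Lemma le_integrableR d (T : measurableType d) (m : {measure set T -> \bar R}) (f g : T -> R) :
  measurable_fun setT f -> (forall x, `|f x| <= g x) ->
  m.-integrable setT (EFin \o g) -> m.-integrable setT (EFin \o f).
Proof.
move=> mf fg; apply: le_integrable => //; first exact/measurable_EFinP.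
move=> x _ /=; rewrite lee_fin; apply: (le_trans (fg x)); exact: ler_norm.
Qed.

Lemma integrable_DR d (T : measurableType d) (m : {measure set T -> \bar R}) (f g : T -> R) :
  m.-integrable setT (EFin \o f) -> m.-integrable setT (EFin \o g) ->
  m.-integrable setT (EFin \o (fun x => f x + g x)).
Proof. by move=> fi gi; apply: eq_integrable (integrableD measurableT fi gi). Qed.

Lemma integrable_BR d (T : measurableType d) (m : {measure set T -> \bar R}) (f g : T -> R) :
  m.-integrable setT (EFin \o f) -> m.-integrable setT (EFin \o g) ->
  m.-integrable setT (EFin \o (fun x => f x - g x)).
Proof. by move=> fi gi; apply: eq_integrable (integrableB measurableT fi gi). Qed.

Lemma integrable_ZR d (T : measurableType d) (m : {measure set T -> \bar R}) k (f : T -> R) :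
  m.-integrable setT (EFin \o f) -> m.-integrable setT (EFin \o (fun x => k * f x)).
Proof. by move=> fi; apply: eq_integrable (integrableZl measurableT k fi). Qed.

Lemma measurable_integrableR d (T : measurableType d) (m : {measure set T -> \bar R}) (f : T -> R) :
  m.-integrable setT (EFin \o f) -> measurable_fun setT f.
Proof. by move=> /measurable_int /measurable_EFinP. Qed.

Lemma EFin_Rintegral d (T : measurableType d) (m : {measure set T -> \bar R}) (f : T -> R) :
  m.-integrable setT (EFin \o f) -> (\int[m]_x f x)%:E = (\int[m]_x (f x)%:E)%E.
Proof. by move=> fi; rewrite /Rintegral fineK//; exact: integrable_fin_num. Qed.

Section conv.
Variables (a k : R -> R).
Hypothesis (ai : mu.-integrable setT (EFin \o a)) (ki : mu.-integrable setT (EFin \o k)).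
Hypothesis (a0 : forall x, 0 <= a x) (k0 : forall x, 0 <= k x).

Let ma := measurable_integrableR ai.
Let mk := measurable_integrableR ki.

Let m1 : measurable_fun setT (fun p : R * R => a p.1 * k (p.1 - p.2)).
Proof.
apply: measurable_funM; first exact: measurableT_comp.
by apply: measurableT_comp => //; exact: measurable_sub12.
Qed.

Let m2 : measurable_fun setT (fun p : R * R => a p.2 * k (p.1 - p.2)).
Proof.
apply: measurable_funM; first exact: measurableT_comp.
by apply: measurableT_comp => //; exact: measurable_sub12.
Qed.

Let in1 (c : R) x : (\int[mu]_y (c * k (x - y))%:E = c%:E * (\int[mu]_y k y)%:E)%E.
Proof.
rewrite EFin_Rintegral// -(@ge0_integral_subl x (EFin \o k)) /=; last 2 first.
- exact/measurable_EFinP.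
- by move=> y; rewrite lee_fin.
under eq_integral do rewrite EFinM.
rewrite integralZl//.
apply: integrable_ge0P => //.
- by apply: measurableT_comp => //; exact: measurable_subl.
rewrite (@ge0_integral_subl x (EFin \o k)) /=; last 2 first.
- exact/measurable_EFinP.
- by move=> y; rewrite lee_fin.
by rewrite -EFin_Rintegral// ltry.
Qed.

Let e1 : (\int[mu2]_p (a p.1 * k (p.1 - p.2))%:E =
  ((\int[mu]_x a x) * (\int[mu]_x k x))%:E)%E.
Proof.
rewrite fubini_tonelli1; last 2 first.
- exact/measurable_EFinP.
- by move=> p; rewrite lee_fin mulr_ge0.
rewrite /fubini_F /=.
under eq_integral do rewrite in1.
by rewrite integralZr// EFinM -EFin_Rintegral.
Qed.

Hypothesis kN : forall t, k (- t) = k t.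

Let e2 : (\int[mu2]_p (a p.2 * k (p.1 - p.2))%:E =
  ((\int[mu]_x a x) * (\int[mu]_x k x))%:E)%E.
Proof.
rewrite fubini_tonelli2; last 2 first.
- exact/measurable_EFinP.
- by move=> p; rewrite lee_fin mulr_ge0.
rewrite /fubini_G /=.
under eq_integral => y _.
  under eq_integral => x _ do rewrite -kN opprB.
  rewrite in1.
  over.
by rewrite /= integralZr// EFinM -EFin_Rintegral.
Qed.

(** By Tonelli the double integral is the product of the masses of a and k. This is the source of
    absolute convergence for all integrals near the diagonal; evenness of k gives the mirror version
    with the weight in the second variable. *)
Lemma conv1_integrable :
  mu2.-integrable setT (EFin \o (fun p : R * R => a p.1 * k (p.1 - p.2))).
Proof.
apply: integrable_ge0P => //; last by rewrite e1 ltry.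
by move=> p; rewrite mulr_ge0.
Qed.

Lemma conv2_integrable :
  mu2.-integrable setT (EFin \o (fun p : R * R => a p.2 * k (p.1 - p.2))).
Proof.
apply: integrable_ge0P => //; last by rewrite e2 ltry.
by move=> p; rewrite mulr_ge0.
Qed.

Lemma conv1E : \int[mu2]_p (a p.1 * k (p.1 - p.2)) = (\int[mu]_x a x) * (\int[mu]_x k x).
Proof. by rewrite /Rintegral e1. Qed.

Lemma conv2E : \int[mu2]_p (a p.2 * k (p.1 - p.2)) = (\int[mu]_x a x) * (\int[mu]_x k x).
Proof. by rewrite /Rintegral e2. Qed.

End conv.

Section fub.
Variable F : R * R -> R.
Hypothesis Fi : mu2.-integrable setT (EFin \o F).

Lemma measurable_swap : measurable_fun setT (fun p : R * R => (p.2, p.1)).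
Proof. by apply: measurable_fun_pair. Qed.

Lemma swap_integrable : mu2.-integrable setT (EFin \o (fun p => F (p.2, p.1))).
Proof.
have mF := measurable_integrableR Fi.
have mG : measurable_fun setT (fun p : R * R => F (p.2, p.1)).
  by apply: (measurableT_comp mF); exact: measurable_swap.
apply/(integrable12ltyP mu mu); first exact/measurable_EFinP.
by move/(integrable21ltyP mu mu (measurable_int _ Fi)): (Fi).
Qed.

Lemma swap_Rintegral : \int[mu2]_p F (p.2, p.1) = \int[mu2]_p F p.
Proof.
rewrite /Rintegral; congr fine.
by rewrite -(integral12_prod_meas1 swap_integrable) -(integral21_prod_meas1 Fi).
Qed.

Lemma iter_ereal : (\int[mu]_x \int[mu]_y (F (x, y))%:E = (\int[mu2]_p F p)%:E)%E.
Proof. by rewrite EFin_Rintegral// -(integral12_prod_meas1 Fi). Qed.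

(** The real inner integral is known to agree with the extended one only at those x where the
    section of [F] is integrable, which is almost every x. Hence the passage through [ae_eq]. *)
Lemma iter_Rintegral :
  mu.-integrable setT (EFin \o (fun x => \int[mu]_y F (x, y))) /\
  \int[mu]_x (\int[mu]_y F (x, y)) = \int[mu2]_p F p.
Proof.
have iF := integrable_fubini_F Fi.
have mF := measurable_int _ iF.
have ae : ae_eq mu setT (fun x => (\int[mu]_y F (x, y))%:E)
    (fun x => \int[mu]_y (F (x, y))%:E)%E.
  have := ae_integrable1 Fi; apply: filterS => x xi _.
  by rewrite EFin_Rintegral.
have m : measurable_fun setT (fun x => (\int[mu]_y F (x, y))%:E).
  apply/measurable_EFinP; rewrite /Rintegral.
  apply: (@measurableT_comp _ _ _ _ _ _ (@fine R)) => //.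
split.
  apply/integrableP; split => //.
  move/integrableP : iF => [_]; apply: le_lt_trans.
  rewrite le_eqVlt; apply/orP; left; apply/eqP.
  have mabs : measurable_fun setT (abse \o (fun x => (\int[mu]_y F (x, y))%:E)).
    exact: measurableT_comp.
  have mabs' : measurable_fun setT (abse \o fubini_F mu (EFin \o F)).
    exact: measurableT_comp.
  have aeabs : ae_eq mu setT (abse \o (fun x => (\int[mu]_y F (x, y))%:E))
      (abse \o fubini_F mu (EFin \o F)).
    by apply: filterS ae => x h hD; congr (abse _); exact: h.
  exact: (@ae_eq_integral _ _ _ mu _ _ _ measurableT mabs mabs' aeabs).
rewrite [in LHS]/Rintegral; congr fine.
rewrite [LHS](@ae_eq_integral _ _ _ mu _ _ _ measurableT m mF ae)//.
by rewrite -(integral12_prod_meas1 Fi).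
Qed.

End fub.

End Measure.

(** * The energy space and the bilinear form *)

Ltac mfun := repeat first
  [ assumption
  | exact: measurable_fst | exact: measurable_snd | exact: measurable_cst
  | exact: measurable_sub12
  | apply: measurable_funM | apply: measurable_funB | apply: measurable_funD
  | apply: measurable_funX
  | match goal with h : measurable_fun setT ?u |- measurable_fun _ (fun p => ?u (@fst _ _ p)) =>
      exact: (measurableT_comp h measurable_fst) end
  | match goal with h : measurable_fun setT ?u |- measurable_fun _ (fun p => ?u (@snd _ _ p)) =>
      exact: (measurableT_comp h measurable_snd) end
  | match goal with h : measurable_fun setT ?u |- measurable_fun _ (fun x => ?u _) =>
      apply: (measurableT_comp h) end ].

Section Prod.
Context {R : realType}.
Local Notation mu := (@lebesgue_measure R).
Local Notation mu2 := (mu \x mu)%E.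

Lemma prod_integrable (a b : R -> R) :
  mu.-integrable setT (EFin \o a) -> mu.-integrable setT (EFin \o b) ->
  (forall x, 0 <= a x) -> (forall x, 0 <= b x) ->
  mu2.-integrable setT (EFin \o (fun p => a p.1 * b p.2)) /\
  \int[mu2]_p (a p.1 * b p.2) = (\int[mu]_x a x) * (\int[mu]_x b x).
Proof.
move=> ai bi a0 b0.
have ma := measurable_integrableR ai.
have mb := measurable_integrableR bi.
have m : measurable_fun setT (fun p : R * R => a p.1 * b p.2) by mfun.
have e : (\int[mu2]_p (a p.1 * b p.2)%:E = ((\int[mu]_x a x) * (\int[mu]_x b x))%:E)%E.
  rewrite fubini_tonelli1; last 2 first.
  - exact/measurable_EFinP.
  - by move=> p; rewrite lee_fin mulr_ge0.
  rewrite /fubini_F /=.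
  have h x : (\int[mu]_y (a x * b y)%:E = (a x)%:E * \int[mu]_y (b y)%:E)%E.
    by under eq_integral do rewrite EFinM; rewrite integralZl.
  under eq_integral do rewrite h -EFin_Rintegral//.
  by rewrite integralZr// EFinM -EFin_Rintegral.
split; last by rewrite /Rintegral e.
apply: integrable_ge0P => //; last by rewrite e ltry.
by move=> p; rewrite mulr_ge0.
Qed.
End Prod.

Section Forms.
Context {R : realType}.
Local Notation mu := (@lebesgue_measure R).
Local Notation mu2 := (mu \x mu)%E.
Variable L : R.
Hypothesis L0 : 0 < L.
Local Notation Omega := (`]0, L[%classic : set R).

(* Both kernels are finite everywhere, the first being 0 on the diagonal. *)
Definition nearker (p : R * R) : R := if `|p.1 - p.2| < 1 then `|p.1 - p.2|^-1 else 0.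
Definition farker (p : R * R) : R := if 1 <= `|p.1 - p.2| then `|p.1 - p.2|^-1 else 0.

Lemma nearker_ge0 p : 0 <= nearker p.
Proof. by rewrite /nearker; case: ifP => // _; rewrite invr_ge0. Qed.

Lemma farker_ge0 p : 0 <= farker p.
Proof. by rewrite /farker; case: ifP => // _; rewrite invr_ge0. Qed.

Lemma farker_le1 p : farker p <= 1.
Proof.
by rewrite /farker; case: ifP => // h; rewrite invf_le1// (lt_le_trans _ h).
Qed.

Lemma nearker_swap p : nearker (p.2, p.1) = nearker p.
Proof. by rewrite /nearker /= distrC. Qed.

Lemma farker_swap p : farker (p.2, p.1) = farker p.
Proof. by rewrite /farker /= distrC. Qed.

Lemma measurable_abs12 : measurable_fun setT (fun p : R * R => `|p.1 - p.2|).
Proof. by apply: measurableT_comp => //; exact: measurable_sub12. Qed.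

Lemma measurable_absV12 : measurable_fun setT (fun p : R * R => `|p.1 - p.2|^-1).
Proof.
by apply: (measurableT_comp measurable_invr_norm); exact: measurable_sub12.
Qed.

Lemma measurable_nearker : measurable_fun setT nearker.
Proof.
apply: measurable_fun_ifT => //; last exact: measurable_absV12.
by apply: measurable_fun_ltr => //; exact: measurable_abs12.
Qed.

Lemma measurable_farker : measurable_fun setT farker.
Proof.
apply: measurable_fun_ifT => //; last exact: measurable_absV12.
by apply: measurable_fun_ler => //; exact: measurable_abs12.
Qed.

Definition indO (x : R) : R := \1_Omega x.

Lemma indO_ge0 x : 0 <= indO x. Proof. by rewrite /indO indicE. Qed.

Lemma indO_int : mu.-integrable setT (EFin \o indO) /\ \int[mu]_x indO x = L.
Proof.
have e : (\int[mu]_x (indO x)%:E = L%:E)%E.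
  rewrite /indO integral_indic// setIT.
  transitivity (mu `]0, L[%classic) => //.
  by rewrite lebesgue_measure_itv/= lte_fin L0 -EFinB subr0.
split; last by rewrite /Rintegral e.
apply: integrable_ge0P; [exact: measurable_indic|exact: indO_ge0|].
by rewrite e ltry.
Qed.

Lemma indO_out (u : R -> R) x : vanishes_outside Omega u -> indO x * u x = u x.
Proof.
move=> vu; rewrite /indO indicE; case: (pselect (Omega x)) => h.
  by rewrite mem_set// mul1r.
by rewrite vu// mulr0.
Qed.

(** [spaceH] recast as absolute convergence of integrals over the line and the plane, the form in
    which linearity and Fubini apply; see [spaceH_inH]. *)
Definition inH (u : R -> R) :=
  [/\ measurable_fun setT u,
      mu.-integrable setT (EFin \o (fun x => u x ^+ 2)),
      mu2.-integrable setT (EFin \o (fun p => nearker p * (u p.1 - u p.2) ^+ 2))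
    & vanishes_outside Omega u].

Definition energy (u : R -> R) : R := \int[mu2]_p (nearker p * (u p.1 - u p.2) ^+ 2).
Definition L2sq (u : R -> R) : R := \int[mu]_x (u x ^+ 2).

(** [EL] with its iterated extended-real integral replaced by a real integral over the plane. The
    two are identified on H in [EL_bform]. *)
Definition bform (u v : R -> R) : R :=
  2^-1 * \int[mu2]_p (nearker p * ((u p.1 - u p.2) * (v p.1 - v p.2)))
  - \int[mu2]_p (farker p * (u p.1 * v p.2))
  + rho1 R * \int[mu]_x (u x * v x).

Lemma mem_itv1 (x y : R) : (y \in `](x - 1)%R, (x + 1)%R[%classic) = (`|x - y| < 1).
Proof.
by rewrite mem_setE in_itv/= ltr_norml; apply/andP/andP => -[? ?]; split; lra.
Qed.

Lemma near_ereal (G : R * R -> R) x :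
  (\int[mu]_(y in `](x - 1)%R, (x + 1)%R[) (G (x, y) / `|x - y|)%:E =
   \int[mu]_y (nearker (x, y) * G (x, y))%:E)%E.
Proof.
rewrite integral_mkcond; apply: eq_integral => y _.
rewrite patchE /nearker /= mulrC mem_itv1.
by case: ifP; rewrite ?mul0r// mulrC.
Qed.

Lemma normH_int (u : R -> R) : normH u =
  poweR (\int[mu]_x \int[mu]_y (nearker (x, y) * (u x - u y) ^+ 2)%:E)%E 2^-1.
Proof.
rewrite /normH; congr (poweR _ _); apply: eq_integral => x _.
rewrite (near_ereal (fun p => `|u p.1 - u p.2| ^+ 2)).
by apply: eq_integral => y _ /=; rewrite real_normK// num_real.
Qed.

Lemma measurable_energy (u : R -> R) : measurable_fun setT u ->
  measurable_fun setT (fun p => nearker p * (u p.1 - u p.2) ^+ 2).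
Proof. by move=> mu_; have := measurable_nearker => ?; mfun. Qed.

Lemma energy_iter (u : R -> R) : measurable_fun setT u ->
  (\int[mu]_x \int[mu]_y (nearker (x, y) * (u x - u y) ^+ 2)%:E =
   \int[mu2]_p (nearker p * (u p.1 - u p.2) ^+ 2)%:E)%E.
Proof.
move=> m; rewrite fubini_tonelli1//.
- by apply/measurable_EFinP; exact: measurable_energy.
- by move=> p; rewrite lee_fin mulr_ge0 ?nearker_ge0// sqr_ge0.
Qed.

Lemma spaceH_inH u : spaceH Omega u <-> inH u.
Proof.
split.
- move=> [u2 uH vu].
  have mu_ : measurable_fun setT u.
    by move: (set_mem (sub_Lfun_mfun u2)).
  split => //; first exact: Lfun2_integrable_sqr.
  apply: integrable_ge0P; first exact: measurable_energy.
  + by move=> p; rewrite mulr_ge0 ?nearker_ge0// sqr_ge0.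
  + move: uH; rewrite normH_int energy_iter// => h.
    apply: (lty_poweRy _ h); by rewrite invr_eq0.
- move=> [mu_ u2 uD vu]; split => //.
  + apply/andP; split; first by apply/mem_set.
    apply/mem_set; rewrite /= /finite_norm.
    rewrite unlock; apply: poweR_lty.
    rewrite (_ : (\int[mu]_x _)%E = (\int[mu]_x (u x ^+ 2)%:E)%E).
      by rewrite -EFin_Rintegral// ltry.
    apply: eq_integral => x _ /=.
    by rewrite powR_mulrn// -normrX ger0_norm// sqr_ge0.
  + by rewrite normH_int energy_iter// -EFin_Rintegral// poweR_EFin ltry.
Qed.

Lemma normH_energy u : inH u -> normH u = (Num.sqrt (energy u))%:E.
Proof.
move=> [m _ uD _]; rewrite normH_int energy_iter// -EFin_Rintegral// poweR_EFin.
rewrite powR12_sqrt//; apply: Rintegral_ge0 => p _.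
by rewrite mulr_ge0 ?nearker_ge0// sqr_ge0.
Qed.

Section pair.
Variables u v : R -> R.
Hypotheses (uH : inH u) (vH : inH v).

Lemma near_integrable :
  mu2.-integrable setT (EFin \o (fun p => nearker p * ((u p.1 - u p.2) * (v p.1 - v p.2)))).
Proof.
have [mu_ u2 uD vu] := uH; have [mv v2 vD vv] := vH.
apply: (le_integrableR _ _ (integrable_DR uD vD)).
- by have := measurable_nearker => ?; mfun.
- move=> p; rewrite normrM (ger0_norm (nearker_ge0 p)) -mulrDr ler_wpM2l ?nearker_ge0//.
  set a := _ - _; set b := _ - _; rewrite normrM -(real_normK (num_real a)) -(real_normK (num_real b)).
  have := sqr_ge0 (`|a| - `|b|); have := sqr_ge0 (`|a| + `|b|); nra.
Qed.

Lemma mul_integrable : mu.-integrable setT (EFin \o (fun x => u x * v x)).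
Proof.
have [mu_ u2 uD vu] := uH; have [mv v2 vD vv] := vH.
apply: (le_integrableR _ _ (integrable_DR u2 v2)).
- by mfun.
- move=> x; rewrite normrM -(real_normK (num_real (u x))) -(real_normK (num_real (v x))).
  have := sqr_ge0 (`|u x| - `|v x|); have := sqr_ge0 (`|u x| + `|v x|); nra.
Qed.

(** Majorant of the far integrand: the kernel is at most 1 there, the product is split by Young's
    inequality with weight t, and each square is paired with the indicator of Omega, of mass L,
    because both functions vanish outside. *)
Definition fardom (t : R) (p : R * R) : R :=
  2^-1 * (t^-1 * (u p.1 ^+ 2 * indO p.2) + t * (indO p.1 * v p.2 ^+ 2)).

Lemma fardom_int t :
  mu2.-integrable setT (EFin \o fardom t) /\
  \int[mu2]_p fardom t p = L / 2 * (t^-1 * L2sq u + t * L2sq v).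
Proof.
have [mu_ u2 uD vu] := uH; have [mv v2 vD vv] := vH.
have [ii iE] := indO_int.
have [i1 E1] := prod_integrable u2 ii (fun x => sqr_ge0 (u x)) indO_ge0.
have [i2 E2] := prod_integrable ii v2 indO_ge0 (fun x => sqr_ge0 (v x)).
have i3 := integrable_DR (integrable_ZR t^-1 i1) (integrable_ZR t i2).
split; first exact: integrable_ZR.
rewrite RintegralZl// RintegralD//; try exact: integrable_ZR.
rewrite !RintegralZl// E1 E2 iE /L2sq; ring.
Qed.

Lemma far_le t p : 0 < t -> `|farker p * (u p.1 * v p.2)| <= fardom t p.
Proof.
move=> t0; have [_ _ _ vu] := uH; have [_ _ _ vv] := vH.
rewrite normrM ger0_norm ?farker_ge0//.
apply: (@le_trans _ _ `|u p.1 * v p.2|).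
  by rewrite ler_piMl// farker_le1.
rewrite /fardom.
have -> : u p.1 ^+ 2 = indO p.1 * u p.1 ^+ 2 by rewrite expr2 mulrA indO_out.
have -> : v p.2 ^+ 2 = indO p.2 * v p.2 ^+ 2 by rewrite expr2 mulrA indO_out.
rewrite -{1}(indO_out p.1 vu) -{1}(indO_out p.2 vv) normrM.
set i := indO p.1; set j := indO p.2; rewrite !normrM.
have i0 : 0 <= i by exact: indO_ge0.
have j0 : 0 <= j by exact: indO_ge0.
rewrite (ger0_norm i0) (ger0_norm j0).
rewrite -(real_normK (num_real (u _))) -(real_normK (num_real (v _))).
set a := `|u _|; set b := `|v _|.
have -> : 2^-1 * (t^-1 * (i * a ^+ 2 * j) + t * (i * (j * b ^+ 2))) =
  i * j * (2^-1 * (t^-1 * a ^+ 2 + t * b ^+ 2)) by ring.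
have -> : i * a * (j * b) = i * j * (a * b) by ring.
rewrite ler_wpM2l ?mulr_ge0//.
rewrite -subr_ge0.
have -> : 2^-1 * (t^-1 * a ^+ 2 + t * b ^+ 2) - a * b = 2^-1 * t^-1 * (a - t * b) ^+ 2.
  by field; rewrite gt_eqF.
by apply: mulr_ge0; [rewrite mulr_ge0// invr_ge0 ltW|exact: sqr_ge0].
Qed.

Lemma far_integrable : mu2.-integrable setT (EFin \o (fun p => farker p * (u p.1 * v p.2))).
Proof.
have [mu_ u2 uD vu] := uH; have [mv v2 vD vv] := vH.
have [fi _] := fardom_int 1.
apply: (le_integrableR _ _ fi).
  by have := measurable_farker => ?; mfun.
by move=> p; exact: far_le.
Qed.

Lemma EL_bform : EL u v = bform u v.
Proof.
rewrite /EL /bform; congr (_ * _ - _ + _).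
- rewrite (_ : (\int[mu]_x _)%E =
      (\int[mu]_x \int[mu]_y (nearker (x, y) * ((u x - u y) * (v x - v y)))%:E)%E).
    by rewrite (iter_ereal near_integrable).
  apply: eq_integral => x _.
  exact: (near_ereal (fun p => (u p.1 - u p.2) * (v p.1 - v p.2))).
- rewrite Rintegral_mkcond; apply: eq_Rintegral => p _.
  rewrite patchE /farker.
  have -> : (p \in [set p : R * R | 1 <= `|p.1 - p.2|]) = (1 <= `|p.1 - p.2|).
    by apply/idP/idP => [/set_mem|] //= h; exact/mem_set.
  by case: ifP => _; rewrite ?mul0r// mulrC.
Qed.

End pair.

End Forms.

Section Algebra.
Context {R : realType}.
Local Notation mu := (@lebesgue_measure R).
Local Notation mu2 := (mu \x mu)%E.

Lemma norm_Rintegral_le d (T : measurableType d) (m : {measure set T -> \bar R}) (f g : T -> R) :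
  m.-integrable setT (EFin \o f) -> m.-integrable setT (EFin \o g) ->
  (forall x, `|f x| <= g x) -> `|\int[m]_x f x| <= \int[m]_x g x.
Proof.
move=> fi gi fg; apply: (le_trans (le_normr_Rintegral measurableT fi)).
by apply: le_Rintegral => //; exact: integrable_norm.
Qed.

Variable L : R.
Hypothesis L0 : 0 < L.
Local Notation inH := (inH L).

Lemma energy_ge0 (u : R -> R) : 0 <= energy u.
Proof. by apply: Rintegral_ge0 => p _; rewrite mulr_ge0 ?nearker_ge0// sqr_ge0. Qed.

Lemma L2sq_ge0 (u : R -> R) : 0 <= L2sq u.
Proof. by apply: Rintegral_ge0 => p _; rewrite sqr_ge0. Qed.

Lemma inH_sub u v : inH u -> inH v -> inH (fun x => u x - v x).
Proof.
move=> [mu_ u2 uD vu] [mv v2 vD vv].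
have mkn := @measurable_nearker R.
split; first by mfun.
- apply: (le_integrableR _ _ (integrable_ZR 2 (integrable_DR u2 v2))); first by mfun.
  move=> x; rewrite ger0_norm ?sqr_ge0//.
  have := sqr_ge0 (u x + v x); nra.
- apply: (le_integrableR _ _ (integrable_ZR 2 (integrable_DR uD vD))); first by mfun.
  move=> p; rewrite (ger0_norm (mulr_ge0 (nearker_ge0 p) (sqr_ge0 _))).
  rewrite -mulrDr [leRHS]mulrCA ler_wpM2l ?nearker_ge0//.
  set a := u _; set b := u _; set c := v _; set d := v _.
  have := sqr_ge0 ((a - b) + (c - d)); nra.
- by move=> x nx; rewrite vu// vv// subr0.
Qed.

Section B2.
Variables u v : R -> R.
Hypotheses (uH : inH u) (vH : inH v).

Lemma bform_sym : bform u v = bform v u.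
Proof.
rewrite /bform; congr (_ * _ - _ + _ * _).
- by apply: eq_Rintegral => p _; rewrite [X in _ * X]mulrC.
- rewrite -(swap_Rintegral (far_integrable L0 vH uH)).
  by apply: eq_Rintegral => p _ /=; rewrite farker_swap [X in _ * X]mulrC.
- by apply: eq_Rintegral => p _; rewrite mulrC.
Qed.

(** Cauchy-Schwarz in additive form. The free weight t decides how much of the second argument has
    to be absorbed: t = 1 in [duality], t = 1/8 in [cea]. *)
Lemma bform_bound (t : R) : 0 < t ->
  `|bform u v| <= t^-1 * (energy u + (L + `|rho1 R|) * L2sq u) + t * (energy v + (L + `|rho1 R|) * L2sq v).
Proof.
move=> t0.
have ti0 : 0 < t^-1 by rewrite invr_gt0.
have [mu_ u2 uD vu] := uH; have [mv v2 vD vv] := vH.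
have h1 : `|\int[mu2]_p (nearker p * ((u p.1 - u p.2) * (v p.1 - v p.2)))| <= t^-1 * energy u + t * energy v.
  have iD := integrable_DR (integrable_ZR t^-1 uD) (integrable_ZR t vD).
  rewrite /energy -!RintegralZl// -RintegralD//; try exact: integrable_ZR.
  apply: norm_Rintegral_le => //; first exact: (near_integrable uH vH).
  move=> p; rewrite normrM (ger0_norm (nearker_ge0 p)).
  set a := _ - _; set b := _ - _.
  have -> : t^-1 * (nearker p * a ^+ 2) + t * (nearker p * b ^+ 2) =
    nearker p * (t^-1 * a ^+ 2 + t * b ^+ 2) by ring.
  rewrite ler_wpM2l ?nearker_ge0//; rewrite normrM -(real_normK (num_real a)) -(real_normK (num_real b)).
  rewrite -subr_ge0.
  have -> : t^-1 * `|a| ^+ 2 + t * `|b| ^+ 2 - `|a| * `|b| =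
     2^-1 * t^-1 * (`|a| - t * `|b|) ^+ 2 + 2^-1 * (t^-1 * `|a| ^+ 2 + t * `|b| ^+ 2).
    by field; rewrite gt_eqF.
  have q1 := sqr_ge0 (`|a| - t * `|b|); have q2 := sqr_ge0 `|a|; have q3 := sqr_ge0 `|b|.
  have p1 : 0 <= 2^-1 * t^-1 by rewrite mulr_ge0// ltW.
  have p2 := mulr_ge0 p1 q1; have p3 := mulr_ge0 (ltW ti0) q2.
  have p4 := mulr_ge0 (ltW t0) q3; lra.
have h2 : `|\int[mu2]_p (farker p * (u p.1 * v p.2))| <= L / 2 * (t^-1 * L2sq u + t * L2sq v).
  have [fi <-] := fardom_int L0 uH vH t.
  by apply: norm_Rintegral_le => // [|p]; [exact: (far_integrable L0 uH vH)|exact: (far_le uH vH)].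
have h3 : `|\int[mu]_x (u x * v x)| <= t^-1 * L2sq u + t * L2sq v.
  have iD := integrable_DR (integrable_ZR t^-1 u2) (integrable_ZR t v2).
  rewrite /L2sq -!RintegralZl// -RintegralD//; try exact: integrable_ZR.
  apply: norm_Rintegral_le => //; first exact: (mul_integrable uH vH).
  move=> x.
  set a := u x; set b := v x; rewrite normrM -(real_normK (num_real a)) -(real_normK (num_real b)).
  rewrite -subr_ge0.
  have -> : t^-1 * `|a| ^+ 2 + t * `|b| ^+ 2 - `|a| * `|b| =
     2^-1 * t^-1 * (`|a| - t * `|b|) ^+ 2 + 2^-1 * (t^-1 * `|a| ^+ 2 + t * `|b| ^+ 2).
    by field; rewrite gt_eqF.
  have q1 := sqr_ge0 (`|a| - t * `|b|); have q2 := sqr_ge0 `|a|; have q3 := sqr_ge0 `|b|.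
  have p1 : 0 <= 2^-1 * t^-1 by rewrite mulr_ge0// ltW.
  have p2 := mulr_ge0 p1 q1; have p3 := mulr_ge0 (ltW ti0) q2.
  have p4 := mulr_ge0 (ltW t0) q3; lra.
rewrite /bform.
apply: (le_trans (ler_normD _ _)); rewrite normrM.
apply: (le_trans (lerD (ler_normB _ _) (lexx _))); rewrite normrM (ger0_norm (_ : 0 <= 2^-1))//.
set X := t^-1 * L2sq u + t * L2sq v in h2 h3 *; set Y := t^-1 * energy u + t * energy v in h1 *.
have -> : t^-1 * (energy u + (L + `|rho1 R|) * L2sq u) + t * (energy v + (L + `|rho1 R|) * L2sq v) =
  Y + L * X + `|rho1 R| * X by rewrite /X /Y; ring.
have X0 : 0 <= X by exact: le_trans h3.
have Y0 : 0 <= Y by exact: le_trans h1.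
have LX : 0 <= L * X by rewrite mulr_ge0// ltW.
have h3' : `|rho1 R| * `|\int[mu]_x (u x * v x)| <= `|rho1 R| * X by rewrite ler_wpM2l.
lra.
Qed.

End B2.

Lemma bform_subl u u' v : inH u -> inH u' -> inH v ->
  bform (fun x => u x - u' x) v = bform u v - bform u' v.
Proof.
move=> uH uH' vH; rewrite /bform.
have -> : \int[mu2]_p (nearker p * ((u p.1 - u' p.1 - (u p.2 - u' p.2)) * (v p.1 - v p.2))) =
  \int[mu2]_p (nearker p * ((u p.1 - u p.2) * (v p.1 - v p.2))) -
  \int[mu2]_p (nearker p * ((u' p.1 - u' p.2) * (v p.1 - v p.2))).
  rewrite -RintegralB//; [|exact: (near_integrable uH vH)|exact: (near_integrable uH' vH)].
  by apply: eq_Rintegral => p _; ring.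
have -> : \int[mu2]_p (farker p * ((u p.1 - u' p.1) * v p.2)) =
  \int[mu2]_p (farker p * (u p.1 * v p.2)) - \int[mu2]_p (farker p * (u' p.1 * v p.2)).
  rewrite -RintegralB//; [|exact: (far_integrable L0 uH vH)|exact: (far_integrable L0 uH' vH)].
  by apply: eq_Rintegral => p _; ring.
have -> : \int[mu]_x ((u x - u' x) * v x) = \int[mu]_x (u x * v x) - \int[mu]_x (u' x * v x).
  rewrite -RintegralB//; [|exact: (mul_integrable uH vH)|exact: (mul_integrable uH' vH)].
  by apply: eq_Rintegral => p _; ring.
ring.
Qed.

Lemma bform_subr u u' v : inH u -> inH u' -> inH v ->
  bform v (fun x => u x - u' x) = bform v u - bform v u'.
Proof.
move=> uH uH' vH; rewrite bform_sym//; last exact: inH_sub.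
by rewrite bform_subl// (bform_sym uH vH) (bform_sym uH' vH).
Qed.

(** A Garding inequality: the near part is exactly half the energy, while the far part and the
    zero-order term are bounded by L^2 norms. *)
Lemma bform_coercive u : inH u -> energy u / 2 <= bform u u + (L + `|rho1 R|) * L2sq u.
Proof.
move=> uH; rewrite /bform.
have [mu_ u2 uD vu] := uH.
have h1 : \int[mu2]_p (nearker p * ((u p.1 - u p.2) * (u p.1 - u p.2))) = energy u.
  by apply: eq_Rintegral => p _; rewrite expr2.
have h2 : `|\int[mu2]_p (farker p * (u p.1 * u p.2))| <= L * L2sq u.
  have [fi fE] := fardom_int L0 uH uH 1.
  have -> : L * L2sq u = L / 2 * (1^-1 * L2sq u + 1 * L2sq u) by rewrite invr1; field.
  rewrite -fE; apply: norm_Rintegral_le => // [|p].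
    exact: (far_integrable L0 uH uH).
  exact: (far_le uH uH).
have h3 : \int[mu]_x (u x * u x) = L2sq u.
  by apply: eq_Rintegral => p _; rewrite expr2.
rewrite h1 h3.
have := ler_norm (\int[mu2]_p (farker p * (u p.1 * u p.2))).
have : - `|rho1 R| * L2sq u <= rho1 R * L2sq u.
  by rewrite ler_wpM2r ?L2sq_ge0// lerNl -normrN ler_norm.
lra.
Qed.

End Algebra.

(** * Powers of the modulus and the logarithmic kernel *)

Section EllPow.
Context {R : realType}.
Implicit Types r s a : R.

Lemma ellp_gt0 a r : 0 < r -> 0 < ellp a r.
Proof. by move=> r0; rewrite powR_gt0// ell_gt0. Qed.

Lemma ellp_ge0 a r : 0 <= ellp a r. Proof. exact: powR_ge0. Qed.

Lemma ellp_le1 a r : 0 <= a -> 0 < r -> ellp a r <= 1.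
Proof.
move=> a0 r0; rewrite -(powRr0 (ell r)); apply: ger_powR => //.
by rewrite ell_gt0// ell_le1.
Qed.

Lemma ellp_mono a r s : 0 <= a -> 0 < r -> r <= s -> ellp a r <= ellp a s.
Proof.
move=> a0 r0 rs; have s0 := lt_le_trans r0 rs.
apply: ge0_ler_powR => //; [exact/ltW/ell_gt0|exact/ltW/ell_gt0|].
by rewrite !ell_ellV lef_pV2 ?posrE ?ellV_gt0// ellV_anti.
Qed.

Lemma ellp_S a r : 0 < r -> ellp a r = ellV r * ellp (1 + a) r.
Proof.
move=> r0; rewrite /ellp powRD; last by rewrite (gt_eqF (ell_gt0 r0)) implybT.
rewrite powRr1 ?ltW ?ell_gt0// mulrA ell_ellV divff ?mul1r//.
by rewrite gt_eqF// ellV_gt0.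
Qed.

(** As [ell r <= 1], raising the exponent to 2 only enlarges the reciprocal. This makes the boundary
    weight independent of alpha. *)
Lemma ellp_inv_le a r : a <= 2 -> 0 < r -> (ellp a r)^-1 <= ellV r ^+ 2.
Proof.
move=> a2 r0; have L1 := ellV_gt0 r0.
rewrite -[leRHS]invrK lef_pV2 ?posrE ?ellp_gt0 ?invr_gt0 ?exprn_gt0//.
rewrite -exprVn -powR_mulrn; last by rewrite invr_ge0 ltW.
rewrite -ell_ellV.
apply: ger_powR => //; by rewrite ell_gt0//= ell_le1.
Qed.

Lemma ellp_small a e : 0 < a -> 0 < e ->
  exists2 d, 0 < d & forall r, 0 < r -> r < d -> ellp a r < e.
Proof.
move=> a0 e0; pose e' := e `^ a^-1.
have e'0 : 0 < e' by exact: powR_gt0.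
(* Below 1/10 the modulus is -1 / ln r, which is less than e' exactly when r < exp(-1/e'). *)
exists (Num.min (10^-1) (expR (- e'^-1))).
  by rewrite lt_min expR_gt0 andbT; lra.
move=> r r0; rewrite lt_min => /andP[r1 r2].
have -> : e = e' `^ a by rewrite -powRrM mulVf ?gt_eqF// powRr1// ltW.
apply: gt0_ltr_powR => //; [exact/ltW/ell_gt0|exact/ltW|].
rewrite ell_ellV -[ltRHS]invrK ltf_pV2 ?posrE ?invr_gt0 ?ellV_gt0//.
rewrite ellV_small//; last exact: ltW.
rewrite ltrNr -ltr_expR lnK ?posrE//.
Qed.

End EllPow.

Section LogkerIntegrable.
Context {R : realType}.
Local Notation mu := (@lebesgue_measure R).
Variable a : R.
Hypothesis a1 : 1 < a.
Hypothesis a2 : a <= 2.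

Lemma integrable_subl (c : R) (f : R -> R) : (forall x, 0 <= f x) ->
  mu.-integrable setT (EFin \o f) -> mu.-integrable setT (EFin \o (fun x => f (c - x))).
Proof.
move=> f0 fi; have mf := measurable_integrableR fi.
apply: integrable_ge0P => //; first by apply: (measurableT_comp mf); exact: measurable_subl.
rewrite (@ge0_integral_subl _ c (EFin \o f)) /=.
- by rewrite -EFin_Rintegral// ltry.
- exact/measurable_EFinP.
- by move=> x; rewrite lee_fin.
Qed.

(** Dominated by the singular part on ]0, 1/10], its mirror image, and 10 on ]-1, 1[, since 1/|t| <=
    10 away from the origin. *)
Lemma logker_integrable : mu.-integrable setT (EFin \o logker a).
Proof.
pose A : set R := `]0, (10^-1)%R]%classic.
pose k1 : R -> R := (fun t => ellp a t / t) \_ A.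
have k10 t : 0 <= k1 t.
  rewrite /k1 patchE; case: ifPn => //; rewrite mem_setE in_itv/= => /andP[t0 _].
  by rewrite mulr_ge0// ?ellp_ge0// invr_ge0 ltW.
have mk1 : measurable_fun setT k1.
  have mA : measurable A by exact: measurable_itv.
  have -> : k1 = (fun t => ellp a t * `|t|^-1 * \1_A t).
    apply/funext => t; rewrite /k1 patchE indicE; case: ifPn => h; last by rewrite mulr0.
    rewrite mulr1 gtr0_norm//; move: h; rewrite mem_setE in_itv/=.
    by case/andP.
  apply: measurable_funM; last exact: measurable_indic.
  apply: measurable_funM; last exact: measurable_invr_norm.
  exact: measurable_ellp.
have ik1 : mu.-integrable setT (EFin \o k1).
  apply: integrable_ge0P => //.
  rewrite (_ : (\int[mu]_x _)%E = (\int[mu]_(t in A) (ellp a t / t)%:E)%E).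
    exact: logker_near0.
  by rewrite [RHS]integral_mkcond; apply: eq_integral => x _; rewrite restrict_EFin.
have ik2 := integrable_subl 0 k10 ik1.
have ik3 : mu.-integrable setT (EFin \o (fun x => 10 * \1_(`]-1, 1[%classic : set R) x)).
  apply: integrable_ZR.
  exact: integrable_indic_itv.
apply: (le_integrableR _ _ (integrable_DR (integrable_DR ik1 ik2) ik3)).
  exact: measurable_logker.
move=> t; rewrite ger0_norm ?logker_ge0// sub0r.
have i0 : 0 <= \1_(`]-1, 1[%classic : set R) t :> R by rewrite indicE.
have p1 := k10 t; have p2 := k10 (- t).
rewrite {1}/logker; case: ifPn => h; last by rewrite !addr_ge0// mulr_ge0.
have key s : 0 < s -> ellp a s / s <= k1 s + 10.
  move=> s0; case: (leP s (10^-1)) => s1.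
    rewrite /k1 patchE mem_setE in_itv/= s0 s1 lerDl//.
  apply: (@le_trans _ _ 10); last by rewrite lerDr.
  rewrite ler_pdivrMr//; apply: (@le_trans _ _ 1); first by apply: ellp_le1 => //; exact: le_trans (ltW a1).
  lra.
have -> : \1_(`]-1, 1[%classic : set R) t = 1 :> R.
  by rewrite indicE mem_set//= in_itv/=; move: h; rewrite ltr_norml.
case: (ltrgt0P t) => t0.
- have := key _ t0; lra.
- have := key (- t); rewrite oppr_gt0 => /(_ t0); lra.
- by rewrite invr0 mulr0 mulr1 !addr_ge0.
Qed.

(** Multiplied by r, this bounds a linear increment by a multiple of [ellp a r], so that Lipschitz
    functions obey the logarithmic modulus. The factor 10 comes from min(1/10, r) >= r / 10 for r <
    1. *)
Lemma logker_lower r : 0 < r -> r < 1 -> 1 <= 10 * 6 ^+ 6 * logker a r.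
Proof.
move=> r0 r1; rewrite /logker gtr0_norm// r1.
have h := ellV_pow6 r0; have L1 := ellV_ge1 r0.
have m : r / 10 <= Num.min (10^-1) r by rewrite le_min; apply/andP; split; lra.
have i := ellp_inv_le a2 r0.
have e0 := ellp_gt0 a r0.
have l2 : ellV r ^+ 2 * (r / 10) <= 6 ^+ 6.
  apply: le_trans h; apply: ler_pM => //; rewrite ?sqr_ge0//; first by lra.
  by rewrite ler_weXn2l.
rewrite mulrA ler_pdivlMr// mul1r.
have : (ellp a r)^-1 * (r / 10) <= 6 ^+ 6.
  by apply: le_trans l2; rewrite ler_wpM2r//; lra.
rewrite mulrC ler_pdivrMr//.
have := @exprn_gt0 R 6 6; lra.
Qed.

(** The fourth power of the logarithm is compared with kappa itself, so the square integrability of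
    the boundary weight follows from that of the kernel already integrated. *)
Lemma ellV4_le r : 0 < r -> ellV r ^+ 4 <= 6 ^+ 6 * logker a r + ellV (10^-1) ^+ 4.
Proof.
move=> r0; have L0 := ellV_gt0 r0.
case: (leP r (10^-1)) => r1.
  apply: (@le_trans _ _ (6 ^+ 6 * logker a r)); last first.
    by rewrite lerDl exprn_ge0// ltW// ellV_gt0// invr_gt0.
  rewrite /logker gtr0_norm// ifT; last by lra.
  have h := ellV_pow6 r0; rewrite min_r// in h.
  have i := ellp_inv_le a2 r0; have e0 := ellp_gt0 a r0.
  have q0 : 0 <= ellp a r / r by apply: mulr_ge0; rewrite ?invr_ge0 ltW.
  have -> : ellV r ^+ 4 = ellV r ^+ 4 * r * (ellp a r)^-1 * (ellp a r / r).
    by field; rewrite !gt_eqF.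
  rewrite ler_wpM2r//; apply: le_trans h.
  rewrite [leRHS](_ : _ = ellV r ^+ 4 * r * ellV r ^+ 2); last by ring.
  by rewrite ler_wpM2l//; apply: mulr_ge0; rewrite ?exprn_ge0// ltW.
apply: (@le_trans _ _ (ellV (10^-1) ^+ 4)); last first.
  by rewrite lerDr mulr_ge0// ?exprn_ge0// logker_ge0.
have q : 0 < 10^-1 :> R by lra.
apply: lerXn2r; rewrite ?nnegrE; [exact/ltW|exact/ltW/ellV_gt0|].
by apply: ellV_anti => //; exact: ltW.
Qed.

End LogkerIntegrable.

(** * The boundary weight and the weak formulation of classical solutions *)

Section logreg.
Context {R : realType}.
Local Notation mu := (@lebesgue_measure R).
Local Notation mu2 := (mu \x mu)%E.
Variables (L a : R).
Hypotheses (L0 : 0 < L) (a1 : 1 < a) (a2 : a <= 2).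
Local Notation Omega := (`]0, L[%classic : set R).

Definition odist (x : R) : R := Num.min x (L - x).

Lemma le_odist r x : (r <= odist x) = (r <= x) && (r <= L - x).
Proof. exact: le_min. Qed.

Lemma OmegaP x : Omega x <-> 0 < odist x.
Proof.
rewrite /= in_itv/= lt_min subr_gt0.
by split.
Qed.

(* Halving the distance to the boundary makes the weight at x also control the
   oscillation at the points nearer to the boundary than x by a factor 2. *)
Definition bweight (x : R) : R := indO L x * ellV (odist x / 2) ^+ 2.

Lemma indO1 x : Omega x -> indO L x = 1.
Proof. by move=> h; rewrite /indO indicE mem_set. Qed.

Lemma indO0 x : ~ Omega x -> indO L x = 0.
Proof. by move=> h; rewrite /indO indicE memNset. Qed.

Lemma bweight_in x : Omega x -> bweight x = ellV (odist x / 2) ^+ 2.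
Proof. by move=> h; rewrite /bweight indO1// mul1r. Qed.

Lemma bweight_out x : ~ Omega x -> bweight x = 0.
Proof. by move=> h; rewrite /bweight indO0// mul0r. Qed.

Lemma bweight_ge0 x : 0 <= bweight x.
Proof. by rewrite mulr_ge0 ?indO_ge0// sqr_ge0. Qed.

Lemma bweight_ge1 x : Omega x -> 1 <= bweight x.
Proof.
move=> h; rewrite bweight_in//; move/OmegaP : h => h.
by rewrite exprn_ege1// ellV_ge1// divr_gt0.
Qed.

Lemma bweight_le_sqr x : bweight x <= bweight x ^+ 2.
Proof.
case: (pselect (Omega x)) => h; last by rewrite bweight_out// expr0n.
by have := bweight_ge1 h; nra.
Qed.

Lemma measurable_indO : measurable_fun setT (@indO R L).
Proof. exact: measurable_indic. Qed.

Lemma measurable_bweight : measurable_fun setT bweight.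
Proof.
apply: measurable_funM; first exact: measurable_indO.
apply: measurable_funX; apply: (measurableT_comp (@measurable_ellV R)).
apply: measurable_funM => //; apply: measurable_minr => //.
exact: measurable_subl.
Qed.

Lemma bweight_sqr_integrable : mu.-integrable setT (EFin \o (fun x => bweight x ^+ 2)).
Proof.
have ik := logker_integrable a1.
have ik' := integrable_subl L (logker_ge0 a) ik.
have [ii _] := indO_int L0.
(* 16 = 2^4 pays for halving the distance through [ellV_half]. *)
pose c := 16 * 6 ^+ 6 : R; pose c4 := 32 * ellV (10^-1) ^+ 4 : R.
apply: (le_integrableR _ _ (integrable_DR (integrable_DR (integrable_ZR c ik)
  (integrable_ZR c ik')) (integrable_ZR c4 ii))).
  by apply: measurable_funX; exact: measurable_bweight.
move=> x; rewrite ger0_norm ?sqr_ge0//.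
have k1 := logker_ge0 a x; have k2 := logker_ge0 a (L - x).
have c0 : 0 <= c by rewrite /c mulr_ge0// exprn_ge0.
case: (pselect (Omega x)) => h; last first.
  rewrite bweight_out// indO0// expr0n /= mulr0 addr0.
  by apply: addr_ge0; exact: mulr_ge0.
rewrite bweight_in// indO1// mulr1 -exprM.
have [x0 xL] : 0 < x /\ 0 < L - x.
  by move: h; rewrite /= in_itv/= => /andP[? ?]; split => //; rewrite subr_gt0.
have h4 r : 0 < r -> ellV (r / 2) ^+ 4 <= c * logker a r + 16 * ellV (10^-1) ^+ 4.
  move=> r0; apply: (@le_trans _ _ ((2 * ellV r) ^+ 4)).
    by apply: lerXn2r; rewrite ?nnegrE ?mulr_ge0 ?ellV_half// ltW// ellV_gt0// divr_gt0.
  rewrite exprMn; have := ellV4_le a2 r0; rewrite /c.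
  have -> : 2 ^+ 4 = 16 :> R by ring.
  lra.
have l4 : 0 <= ellV (10^-1 : R) ^+ 4 by apply: exprn_ge0; exact: normr_ge0.
have m1 := mulr_ge0 c0 k1; have m2 := mulr_ge0 c0 k2.
rewrite /odist minElt /c4; case: ifP => _.
  have := h4 _ x0; lra.
have := h4 _ xL; lra.
Qed.

Definition pairweight (p : R * R) : R := (bweight p.1 ^+ 2 + bweight p.2 ^+ 2) * logker a (p.1 - p.2).

Lemma pairweight_integrable : mu2.-integrable setT (EFin \o pairweight).
Proof.
have ik := logker_integrable a1.
have h := integrable_DR
  (conv1_integrable bweight_sqr_integrable ik (fun x => sqr_ge0 (bweight x)) (logker_ge0 a))
  (conv2_integrable bweight_sqr_integrable ik (fun x => sqr_ge0 (bweight x)) (logker_ge0 a) (logkerN a)).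
by apply: eq_integrable h => // p _; rewrite /= /pairweight mulrDl.
Qed.

Lemma pairweight_ge0 p : 0 <= pairweight p.
Proof. by rewrite mulr_ge0 ?logker_ge0// addr_ge0 ?sqr_ge0. Qed.

(* Satisfied by the functions of X^alpha, and by those of V_h in spite of their
   jumps at the end points. *)
Definition logreg (M : R) (v : R -> R) :=
  [/\ measurable_fun setT v, vanishes_outside Omega v, forall x, `|v x| <= M
    & forall p, nearker p * `|v p.1 - v p.2| <= M * ((bweight p.1 + bweight p.2) * logker a (p.1 - p.2))].

Lemma logreg_ge0 M v : logreg M v -> 0 <= M.
Proof. by move=> [_ _ h _]; exact: le_trans (h 0). Qed.

(** One of the two increments in the square is spent on the kernel; the other is bounded by 2 M. *)
Lemma logreg_inH M v : logreg M v -> inH L v.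
Proof.
move=> Dv; have M0 := logreg_ge0 Dv; have [mv vv bv kv] := Dv.
have [ii _] := indO_int L0.
split => //.
- apply: (le_integrableR _ _ (integrable_ZR (M ^+ 2) ii)); first by mfun.
  move=> x; rewrite ger0_norm ?sqr_ge0//.
  case: (pselect (Omega x)) => h; last by rewrite vv// indO0// mulr0 expr0n.
  rewrite indO1// mulr1 -(real_normK (num_real (v x))).
  by apply: lerXn2r; rewrite ?nnegrE.
- apply: (le_integrableR _ _ (integrable_ZR (2 * M * M) pairweight_integrable)).
    exact: measurable_energy.
  move=> p; rewrite (ger0_norm (mulr_ge0 (nearker_ge0 p) (sqr_ge0 _))).
  have -> : nearker p * (v p.1 - v p.2) ^+ 2 = (nearker p * `|v p.1 - v p.2|) * `|v p.1 - v p.2|.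
    by rewrite -mulrA -expr2 real_normK// num_real.
  apply: (@le_trans _ _ (M * ((bweight p.1 + bweight p.2) * logker a (p.1 - p.2)) * (2 * M))).
    apply: ler_pM => //; first by rewrite mulr_ge0// nearker_ge0.
    apply: (le_trans (ler_normB _ _)); have := bv p.1; have := bv p.2; lra.
  rewrite [leLHS](_ : _ = 2 * M * M * ((bweight p.1 + bweight p.2) * logker a (p.1 - p.2))); last by ring.
  rewrite ler_wpM2l ?mulr_ge0//= /pairweight ler_wpM2r ?logker_ge0//.
  by apply: lerD; exact: bweight_le_sqr.
Qed.

Section pairing.
Variables (M : R) (w z g : R -> R).
Hypotheses (wreg : logreg M w) (zH : inH L z).
Hypothesis wg : classical_solution Omega g w.

Let F1 (p : R * R) := nearker p * (w p.1 - w p.2) * z p.1.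
Let F3 (p : R * R) := farker p * (z p.1 * w p.2).

(** The function z has no modulus of continuity, so the kernel is tamed by w alone. The product of D
    and |z| is then split into squares, each integrable against kappa. *)
Let F1i : mu2.-integrable setT (EFin \o F1).
Proof.
have M0 := logreg_ge0 wreg; have [mw vw bw kw] := wreg; have [mz z2 zD vz] := zH.
have iz := conv1_integrable z2 (logker_integrable a1) (fun x => sqr_ge0 (z x)) (logker_ge0 a).
have mkn := @measurable_nearker R.
apply: (le_integrableR _ _ (integrable_ZR M (integrable_DR pairweight_integrable iz))).
  by rewrite /F1; mfun.
move=> p; rewrite /F1 normrM normrM (ger0_norm (nearker_ge0 p)).
apply: (@le_trans _ _ (M * ((bweight p.1 + bweight p.2) * logker a (p.1 - p.2)) * `|z p.1|)).
  by rewrite ler_wpM2r.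
rewrite -mulrA ler_wpM2l// /pairweight mulrAC -mulrDl ler_wpM2r ?logker_ge0//.
rewrite -(real_normK (num_real (z p.1))).
have d1 := bweight_ge0 p.1; have d2 := bweight_ge0 p.2.
have := sqr_ge0 (bweight p.1 - `|z p.1|); have := sqr_ge0 (bweight p.2 - `|z p.1|).
set x := bweight _ in d1 *; set y := bweight _ in d2 *; set t := `|_|.
have := sqr_ge0 x; have := sqr_ge0 y; nra.
Qed.

Let F3i : mu2.-integrable setT (EFin \o F3).
Proof. exact: (far_integrable L0 zH (logreg_inH wreg)). Qed.

(** The symmetric double integral is the sum of [F1] and its mirror image, each absolutely
    integrable, so it equals twice the integral of [F1]. Integrating in y first rebuilds
    [LDelta w x * z x]; outside Omega, where no equation holds, z vanishes. *)
Lemma classical_weak : bform w z = \int[mu]_(x in Omega) (g x * z x).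
Proof.
have wH := logreg_inH wreg.
have [mw vw bw kw] := wreg; have [mz z2 zD vz] := zH.
have [i1 e1] := iter_Rintegral F1i; have [i3 e3] := iter_Rintegral F3i.
have iwz := mul_integrable wH zH.
rewrite /bform.
have -> : \int[mu2]_p (nearker p * ((w p.1 - w p.2) * (z p.1 - z p.2))) = 2 * \int[mu2]_p F1 p.
  transitivity (\int[mu2]_p (F1 p + F1 (p.2, p.1))).
    apply: eq_Rintegral => p _; rewrite /F1 /= nearker_swap; ring.
  rewrite RintegralD//; last exact: swap_integrable.
  by rewrite (swap_Rintegral F1i) -mulr2n mulr_natl.
have -> : \int[mu2]_p (farker p * (w p.1 * z p.2)) = \int[mu2]_p F3 p.
  rewrite -(swap_Rintegral F3i); apply: eq_Rintegral => p _.
  by rewrite /F3 /= farker_swap [X in _ * X]mulrC.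
rewrite mulrA mulVf// mul1r -e1 -e3.
rewrite -RintegralB// -(RintegralZl _ measurableT iwz) -RintegralD//; last 2 first.
- exact: integrable_BR.
- exact: integrable_ZR.
rewrite [RHS]Rintegral_mkcond; apply: eq_Rintegral => x _.
rewrite patchE; case: ifPn => h; last first.
  have zx : z x = 0 by apply: vz => h'; move: h; rewrite mem_set.
  rewrite /F1 /F3 /= zx !mulr0.
  under eq_Rintegral do rewrite mulr0.
  under [X in _ - X]eq_Rintegral do rewrite mul0r mulr0.
  by rewrite !Rintegral_cst// !mul0r subr0 addr0.
(* The two integrability clauses of [classical_solution] are what permits moving the factor z x
   inside the integrals. *)
move/set_mem : h => Ox; have [h1 h2 <-] := wg Ox.
rewrite /LDelta; set P := (X in (X - _ + _) * z x); set Q := (X in (_ - X + _) * z x).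
have -> : (P - Q + rho1 R * w x) * z x = P * z x - Q * z x + rho1 R * (w x * z x) by ring.
rewrite /P /Q; congr (_ - _ + _).
- rewrite [in RHS]Rintegral_mkcond -RintegralZr//; last first.
    have := (@integrable_mkcond _ _ _ mu _ _ (measurable_itv _)).1 h1.
    by move=> h; apply: eq_integrable h => // y _; rewrite /= restrict_EFin.
  apply: eq_Rintegral => y _; rewrite /F1 /= patchE /nearker /=.
  rewrite mem_itv1.
  by case: ifP => _; rewrite ?mul0r// [X in X * _]mulrC.
- rewrite [in RHS]Rintegral_mkcond -RintegralZr//; last first.
    have mI : measurable (~` `](x - 1)%R, (x + 1)%R[%classic) by exact: measurableC.
    have := (@integrable_mkcond _ _ _ mu _ _ mI).1 h2.
    by move=> h; apply: eq_integrable h => // y _; rewrite /= restrict_EFin.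
  apply: eq_Rintegral => y _; rewrite /F3 /= patchE /farker /=.
  rewrite in_setC mem_itv1 -leNgt.
  by case: ifP => _; rewrite ?mul0r//; ring.
Qed.

End pairing.

End logreg.

(** * Pointwise moduli of X^alpha functions and of Lipschitz functions with jumps *)

Section Xbound.
Context {R : realType}.
Local Notation mu := (@lebesgue_measure R).
Variables (L al : R).
Hypotheses (L0 : 0 < L) (al0 : 0 < al) (al1 : al < 1).
Local Notation Omega := (`]0, L[%classic : set R).
Local Notation a := (1 + al).
Local Notation odist := (odist L).
Local Notation bweight := (bweight L).

Let a2 : a <= 2. Proof. by have := al1; lra. Qed.

Lemma odist_out x z : ~ Omega z -> odist x <= `|x - z|.
Proof.
move=> /OmegaP; rewrite lt_min => /negP; rewrite negb_and -!leNgt => /orP[h|h].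
- by apply: (@le_trans _ _ (x - z)); [rewrite ge_min; apply/orP; left; lra|exact: ler_norm].
- rewrite distrC; apply: (@le_trans _ _ (z - x)); last exact: ler_norm.
  by rewrite ge_min; apply/orP; right; lra.
Qed.

(** Boundary points lie outside the open interval, so [odist_out] bounds each distance. The point 0
    is exhibited because the infimum must be over a nonempty set. *)
Lemma bdist_ge x : Omega x -> odist x <= bdist Omega x.
Proof.
have Lp := L0.
move=> Ox; apply: lb_le_inf.
- exists `|x - 0|; exists 0 => //; split.
  + move=> A /nbhs_ballP[e /= e0 be].
    exists (Num.min (e / 2) (L / 2)); split.
      rewrite /= in_itv/=; apply/andP; split; first by rewrite lt_min; apply/andP; split; rewrite divr_gt0.
      by rewrite gt_min; apply/orP; right; lra.
    apply: be; rewrite /ball/=.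
rewrite sub0r normrN ger0_norm; last by rewrite ltW// lt_min; apply/andP; split; lra.
    by rewrite gt_min; apply/orP; left; lra.
  + by move=> /interior_subset; rewrite /= in_itv/= ltxx.
- move=> _ [z [_ zi] <-]; apply: odist_out => Oz; apply: zi.
  by apply: open_nbhs_nbhs; split => //; exact: itv_open.
Qed.

(** The two seminorms of X^alpha with quotients cleared; the reciprocal of [ellp a] at the boundary
    distance is relaxed to [ellV ^+ 2]. *)
Definition Xbound (M : R) (w : R -> R) :=
  [/\ vanishes_outside Omega w,
     forall x y, `|w x - w y| <= M * ellp al `|x - y| &
     forall x y, Omega x -> Omega y ->
       `|w x - w y| <= M * (ellp a `|x - y| * ellV (Num.min (odist x) (odist y)) ^+ 2)].

Lemma normX_Xbound (M : R) w : vanishes_outside Omega w ->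
  (normX Omega al w <= M%:E)%E -> Xbound M w.
Proof.
have Lp := L0.
move=> vw; rewrite /normX.
set S1 := [set _ | p in _]; set S2 := [set _ | p in _] => hM.
(* Each supremum is nonnegative, as one explicit pair of points shows, so each is bounded by their
   sum. *)
have s1 : (0 <= ereal_sup S1)%E.
  apply: ereal_sup_ge => /=.
  exists (`|w 0 - w 1| / ellp al `|0 - 1|)%:E; last first.
    by rewrite lee_fin mulr_ge0// invr_ge0 ellp_ge0.
  by exists (0, 1) => //=; apply/eqP; rewrite eq_sym oner_eq0.
have s2 : (0 <= ereal_sup S2)%E.
  apply: ereal_sup_ge => /=.
  exists (ellp a (bdist2 Omega (L / 2) (L / 3)) *
    (`|w (L / 2) - w (L / 3)| / ellp a `|L / 2 - L / 3|))%:E; last first.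
    by rewrite lee_fin !mulr_ge0// ?invr_ge0 ellp_ge0.
  exists (L / 2, L / 3) => //=; rewrite !in_itv/=; split.
  - apply/andP; split; lra.
  - apply/andP; split; lra.
  - move=> h; lra.
have M0 : 0 <= M by rewrite -lee_fin; apply: le_trans hM; exact: adde_ge0.
have h1 : (ereal_sup S1 <= M%:E)%E by apply: le_trans hM; rewrite leeDl.
have h2 : (ereal_sup S2 <= M%:E)%E by apply: le_trans hM; rewrite leeDr.
split => // x y.
- have [->|xy] := eqVneq x y; first by rewrite !subrr normr0 mulr_ge0// ellp_ge0.
  have d0 : 0 < `|x - y| by rewrite normr_gt0 subr_eq0.
  have : ((`|w x - w y| / ellp al `|x - y|)%:E <= M%:E)%E.
    apply: le_trans h1; apply: ereal_sup_ubound; exists (x, y) => //=; exact/eqP.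
  by rewrite lee_fin ler_pdivrMr// ellp_gt0.
- move=> Ox Oy; have [->|xy] := eqVneq x y.
    rewrite !subrr normr0; apply: mulr_ge0 => //.
    by apply: mulr_ge0; [exact: ellp_ge0|exact: sqr_ge0].
  have d0 : 0 < `|x - y| by rewrite normr_gt0 subr_eq0.
  have : ((ellp a (bdist2 Omega x y) * (`|w x - w y| / ellp a `|x - y|))%:E <= M%:E)%E.
    apply: le_trans h2; apply: ereal_sup_ubound; exists (x, y) => //=; split => //; exact/eqP.
  rewrite lee_fin.
  have m0 : 0 < Num.min (odist x) (odist y) by rewrite lt_min; apply/andP; split; exact/OmegaP.
  have mb : Num.min (odist x) (odist y) <= bdist2 Omega x y.
    rewrite /bdist2 le_min; apply/andP; split.
      by apply: le_trans (bdist_ge Ox); rewrite ge_min lexx.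
    by apply: le_trans (bdist_ge Oy); rewrite ge_min lexx orbT.
  have b0 := lt_le_trans m0 mb.
  have e0 := ellp_gt0 a b0; have e1 := ellp_gt0 a d0.
  rewrite -(ler_pdivlMl _ _ e0) (ler_pdivrMr _ _ e1) => h; apply: (le_trans h).
  rewrite [leLHS](_ : _ = M * (ellp a `|x - y| * (ellp a (bdist2 Omega x y))^-1)); last by ring.
  rewrite ler_wpM2l// ler_wpM2l ?ellp_ge0//.
  apply: (le_trans (ellp_inv_le a2 b0)).
  by apply: lerXn2r; rewrite ?nnegrE ?normr_ge0//; exact: ellV_anti.
Qed.

Lemma ellV_le_bweight x y : Omega x -> Omega y ->
  ellV (Num.min (odist x) (odist y)) ^+ 2 <= bweight x + bweight y.
Proof.
move=> Ox Oy.
have h z : Omega z -> ellV (odist z) ^+ 2 <= bweight z.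
  move=> Oz; rewrite bweight_in//; move/OmegaP : Oz => z0.
  by apply: lerXn2r; rewrite ?nnegrE ?normr_ge0//; apply: ellV_anti; lra.
rewrite minElt; case: ifP => _.
- by apply: (le_trans (h _ Ox)); rewrite lerDl bweight_ge0.
- by apply: (le_trans (h _ Oy)); rewrite lerDr bweight_ge0.
Qed.

(** For a pair straddling the boundary only the global modulus is available, one logarithm short.
    Since |x - y| >= [odist x], the weight at x supplies it. *)
Lemma ellp_le_bweight x y : Omega x -> ~ Omega y ->
  ellp al `|x - y| <= bweight x * ellp a `|x - y|.
Proof.
move=> Ox Oy; have d := odist_out x Oy.
have x0 : 0 < odist x by exact/OmegaP.
have t0 := lt_le_trans x0 d.
rewrite (ellp_S al t0) ler_wpM2r ?ellp_ge0//.
rewrite bweight_in//; apply: (@le_trans _ _ (ellV (odist x / 2))).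
  by apply: ellV_anti; lra.
rewrite expr2 ler_peMl ?normr_ge0// ellV_ge1//; lra.
Qed.

Lemma nearkerE p : p.1 != p.2 -> nearker p = logker a (p.1 - p.2) / ellp a `|p.1 - p.2|.
Proof.
move=> h; rewrite /nearker /logker; case: ifP => _; last by rewrite mul0r.
have t0 : 0 < `|p.1 - p.2| by rewrite normr_gt0 subr_eq0.
by have := ellp_gt0 a t0 => e0; field; rewrite !gt_eqF.
Qed.

Lemma logreg_intro M v : measurable_fun setT v -> vanishes_outside Omega v ->
  (forall x, `|v x| <= M) ->
  (forall x y, x != y -> `|x - y| < 1 -> `|v x - v y| <= M * (bweight x + bweight y) * ellp a `|x - y|) ->
  logreg L a M v.
Proof.
move=> mv vv bv kv; split => // p.
have M0 : 0 <= M by exact: le_trans (bv 0).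
have [->|xy] := eqVneq p.1 p.2.
  by rewrite subrr normr0 mulr0 !mulr_ge0 ?addr_ge0 ?bweight_ge0 ?logker_ge0.
have t0 : 0 < `|p.1 - p.2| by rewrite normr_gt0 subr_eq0.
case: (ltP `|p.1 - p.2| 1) => h1; last first.
  rewrite /nearker ltNge h1 /= mul0r.
  by rewrite !mulr_ge0 ?addr_ge0 ?bweight_ge0 ?logker_ge0.
have e0 := ellp_gt0 a t0.
rewrite nearkerE// mulrAC ler_pdivrMr//.
apply: (@le_trans _ _ (logker a (p.1 - p.2) * (M * (bweight p.1 + bweight p.2) * ellp a `|p.1 - p.2|))).
  by rewrite ler_wpM2l ?logker_ge0// kv.
by rewrite le_eqVlt; apply/orP; left; apply/eqP; ring.
Qed.

Lemma Xbound_ge0 M w : Xbound M w -> 0 <= M.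
Proof.
move=> [_ h _]; have := h 0 1.
have p : 0 < `|0 - 1 : R| by rewrite normr_gt0 sub0r oppr_eq0 oner_eq0.
by move/(le_trans (normr_ge0 _)); rewrite pmulr_lge0// ellp_gt0.
Qed.

Lemma Xbound_continuous M w : Xbound M w -> continuous w.
Proof.
move=> Xw; have M0 := Xbound_ge0 Xw; have [_ h _] := Xw.
move=> x; apply/cvgrPdist_lt => e e0.
have [d d0 hd] := ellp_small al0 (divr_gt0 e0 (ltr_pwDr ltr01 M0)).
near=> y.
have [->|xy] := eqVneq x y; first by rewrite subrr normr0.
have t0 : 0 < `|x - y| by rewrite normr_gt0 subr_eq0.
apply: (le_lt_trans (h x y)).
have : ellp al `|x - y| < e / (M + 1).
  apply: hd => //; near: y; apply/nbhs_ballP; exists d => //= z.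
rewrite ltr_pdivlMr; last by lra.
have := ellp_gt0 al t0; nra.
Unshelve. all: by end_near. Qed.

Lemma Xbound_norm_le M w x : Xbound M w -> `|w x| <= M.
Proof.
move=> Xw; have M0 := Xbound_ge0 Xw; have [vw h _] := Xw.
have [x0|xn] := pselect (Omega x); last by rewrite vw// normr0.
(* The point -1 lies outside Omega, so w vanishes there, and the modulus never exceeds 1. *)
have := h x (-1); rewrite (vw (-1)); last by rewrite /= in_itv/=; lra.
rewrite subr0 => /le_trans; apply.
rewrite ler_piMr//; apply: ellp_le1; first exact: ltW.
by rewrite normr_gt0 opprK; move: x0; rewrite /= in_itv/= => /andP[? _]; rewrite gt_eqF//; lra.
Qed.

Lemma Xbound_logreg M w : Xbound M w -> logreg L a M w.
Proof.
move=> Xw; have M0 := Xbound_ge0 Xw; have [vw h1 h2] := Xw.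
apply: logreg_intro => //.
- apply: continuous_measurable_fun; exact: (Xbound_continuous Xw).
- by move=> x; exact: Xbound_norm_le.
- move=> x y xy t1.
  have [Ox|Ox] := pselect (Omega x); have [Oy|Oy] := pselect (Omega y).
  + apply: (le_trans (h2 _ _ Ox Oy)); rewrite -mulrA ler_wpM2l// mulrC.
    by rewrite ler_wpM2r ?ellp_ge0// ellV_le_bweight.
  + apply: (le_trans (h1 _ _)); rewrite -mulrA ler_wpM2l//.
    by rewrite (bweight_out Oy) addr0 ellp_le_bweight.
  + apply: (le_trans (h1 _ _)); rewrite -mulrA ler_wpM2l//.
    by rewrite (bweight_out Ox) add0r distrC ellp_le_bweight.
  + by rewrite (vw _ Ox) (vw _ Oy) subr0 normr0 (bweight_out Ox) (bweight_out Oy) addr0 mulr0 mul0r lexx.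
Qed.

(** Inside Omega this is [logker_lower]. Across an end point the jump is at most S, while
    [bweight x * ellp a |x - y| >= 1] because |x - y| >= [odist x]: the logarithmic singularity is
    weak enough to tolerate jumps. *)
Lemma lip_logreg S v : measurable_fun setT v -> vanishes_outside Omega v ->
  (forall x, `|v x| <= S) ->
  (forall x y, Omega x -> Omega y -> `|v x - v y| <= S * `|x - y|) ->
  logreg L a (10 * 6 ^+ 6 * S) v.
Proof.
move=> mv vv bv lv.
have S0 : 0 <= S by exact: le_trans (bv 0).
have c1 : 1 <= 10 * 6 ^+ 6 :> R by have := @exprn_ege1 R 6 6; lra.
have SM : S <= 10 * 6 ^+ 6 * S by rewrite ler_peMl.
have M0 := le_trans S0 SM.
apply: logreg_intro => //.
- by move=> x; apply: (le_trans (bv x)).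
have aux x y : Omega x -> ~ Omega y -> `|v x| <= 10 * 6 ^+ 6 * S * (bweight x * ellp a `|x - y|).
  move=> Ox Oy; have d := odist_out x Oy.
  have x0 : 0 < odist x by exact/OmegaP.
  have t0 := lt_le_trans x0 d.
  apply: (le_trans (bv x)); apply: (le_trans SM); rewrite ler_peMr//.
  have e0 := ellp_gt0 a t0.
  rewrite -ler_pdivrMr// div1r; apply: (le_trans (ellp_inv_le a2 t0)).
  rewrite bweight_in//; apply: lerXn2r; rewrite ?nnegrE ?normr_ge0//; apply: ellV_anti; lra.
move=> x y xy t1.
have t0 : 0 < `|x - y| by rewrite normr_gt0 subr_eq0.
have [Ox|Ox] := pselect (Omega x); have [Oy|Oy] := pselect (Omega y).
- apply: (le_trans (lv _ _ Ox Oy)).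
  have k1 := @logker_lower _ a a2 _ t0 t1.
  have kE : logker a `|x - y| * `|x - y| = ellp a `|x - y|.
    by rewrite /logker normr_id t1; field; rewrite gt_eqF.
  apply: (@le_trans _ _ (10 * 6 ^+ 6 * S * ellp a `|x - y|)).
    rewrite -kE [leRHS](_ : _ = S * `|x - y| * (10 * 6 ^+ 6 * logker a `|x - y|)); last by ring.
    by rewrite ler_peMr// mulr_ge0.
  rewrite [leRHS](_ : _ = 10 * 6 ^+ 6 * S * ((bweight x + bweight y) * ellp a `|x - y|)); last by ring.
  rewrite ler_wpM2l// ler_peMl ?ellp_ge0//.
  by have := bweight_ge1 Ox; have := bweight_ge0 L y; lra.
- by rewrite (vv _ Oy) subr0 (bweight_out Oy) addr0 -mulrA; exact: aux.
- by rewrite (vv _ Ox) sub0r normrN (bweight_out Ox) add0r -mulrA distrC; exact: aux.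
- by rewrite (vv _ Ox) (vv _ Oy) subr0 normr0 (bweight_out Ox) (bweight_out Oy) addr0 mulr0 mul0r lexx.
Qed.

End Xbound.

(** * Finite element functions *)

Section FE.
Context {R : realType}.
Local Notation mu := (@lebesgue_measure R).

(** A finite element function is prescribed on open cells only; continuity extends each affine
    formula to the nodes inside Omega. *)
Lemma continuous_eq_right (f g : R -> R) x b : x < b ->
  {for x, continuous f} -> {for x, continuous g} ->
  (forall y, x < y -> y < b -> f y = g y) -> f x = g x.
Proof.
move=> xb cf cg fg.
have h1 : f @ x^'+ --> f x by apply: cvg_at_right_filter.
have h2 : g @ x^'+ --> g x by apply: cvg_at_right_filter.
have h3 : f @ x^'+ --> g x.
  apply: cvg_trans h2; apply: near_eq_cvg; near=> y.
  apply/esym/fg.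
  - by near: y; exact: nbhs_right_gt.
  - by near: y; exact: nbhs_right_lt.
by rewrite -(cvg_lim (@norm_hausdorff _ R) h1) -(cvg_lim (@norm_hausdorff _ R) h3).
Unshelve. all: by end_near. Qed.

Lemma continuous_eq_left (f g : R -> R) x b : b < x ->
  {for x, continuous f} -> {for x, continuous g} ->
  (forall y, b < y -> y < x -> f y = g y) -> f x = g x.
Proof.
move=> xb cf cg fg.
have h1 : f @ x^'- --> f x by apply: cvg_at_left_filter.
have h2 : g @ x^'- --> g x by apply: cvg_at_left_filter.
have h3 : f @ x^'- --> g x.
  apply: cvg_trans h2; apply: near_eq_cvg; near=> y.
  apply/esym/fg.
  - by near: y; exact: nbhs_left_gt.
  - by near: y; exact: nbhs_left_lt.
by rewrite -(cvg_lim (@norm_hausdorff _ R) h1) -(cvg_lim (@norm_hausdorff _ R) h3).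
Unshelve. all: by end_near. Qed.

Lemma horner_size2 (p : {poly R}) x : (size p <= 2)%N -> p.[x] = p`_0 + p`_1 * x.
Proof.
by move=> h; rewrite (horner_coef_wide _ h) !big_ord_recr big_ord0 /= expr0 expr1 add0r mulr1.
Qed.

Variables (L : R).
Hypothesis L0 : 0 < L.
Local Notation Omega := (`]0, L[%classic : set R).

Section spaceV_lip.
Variables (N : nat) (v : R -> R).
Hypothesis Vv : spaceV L N v.
Let h := L / N.+1%:R.
Let h0 : 0 < h. Proof. by rewrite divr_gt0. Qed.

(** Induction on the number of cells: each new cell adds its slope to the constant. A node crossed
    between x and y lies in Omega, where v is continuous. *)
Let lip_upto (k : nat) : (k <= N.+1)%N -> exists2 S, 0 <= S &
  forall x y, Omega x -> Omega y -> x <= y -> y <= k%:R * h -> `|v x - v y| <= S * (y - x).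
Proof.
have [cv vv pv] := Vv.
elim: k => [_|k IH kN].
  exists 0 => // x y; rewrite /= !in_itv/= mul0r => /andP[x0 _] /andP[y0 _] _.
  by rewrite leNgt y0.
have [S S0 hS] := IH (ltnW kN).
have [p p2 hp] := pv k kN.
rewrite -/h in hp.
pose l x := p`_0 + p`_1 * x.
have cl x : {for x, continuous l}.
  by apply: continuousD; [exact: cvg_cst|apply: continuousM; [exact: cvg_cst|exact: cvg_id]].
have kk : k%:R * h < k.+1%:R * h by rewrite ltr_pM2r// ltr_nat.
have vl x : k%:R * h < x -> x < k.+1%:R * h -> v x = l x.
  by move=> x1 x2; rewrite hp ?horner_size2// in_itv/= x1.
have vl' x : Omega x -> k%:R * h <= x -> x <= k.+1%:R * h -> v x = l x.
  move=> Ox; rewrite le_eqVlt => /predU1P[e1 _|x1].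
    apply: (@continuous_eq_right _ _ _ (k.+1%:R * h)) => //; first by rewrite -e1.
      by apply: cv; rewrite inE.
    by move=> y; rewrite -e1 => ? ?; exact: vl.
  rewrite le_eqVlt => /predU1P[e2|x2]; last exact: vl.
  apply: (@continuous_eq_left _ _ _ (k%:R * h)) => //.
    by apply: cv; rewrite inE.
  by move=> y; rewrite e2 => ? ?; exact: vl.
have aff x y : Omega x -> Omega y -> k%:R * h <= x -> x <= y -> y <= k.+1%:R * h ->
    `|v x - v y| <= `|p`_1| * (y - x).
  move=> Ox Oy kx xy yk; rewrite vl' ?(le_trans xy)// vl'// ?(le_trans kx)//.
  rewrite /l [X in `|X|](_ : _ = p`_1 * (x - y)); last by ring.
  by rewrite normrM distrC (ger0_norm (_ : 0 <= y - x))// subr_ge0.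
exists (S + `|p`_1|); first by rewrite addr_ge0.
move=> x y Ox Oy xy yk.
have yx : 0 <= y - x by rewrite subr_ge0.
have q1 : 0 <= S * (y - x) by exact: mulr_ge0.
have q2 : 0 <= `|p`_1| * (y - x) by exact: mulr_ge0.
rewrite mulrDl.
case: (leP y (k%:R * h)) => yk'.
  by apply: (le_trans (hS _ _ Ox Oy xy yk')); rewrite lerDl.
case: (leP (k%:R * h) x) => xk.
  by apply: (le_trans (aff _ _ Ox Oy xk xy yk)); rewrite lerDr.
have On : Omega (k%:R * h).
  move: Ox Oy; rewrite /= !in_itv/= => /andP[x0 _] /andP[_ yL].
  by rewrite (lt_trans x0 xk) (lt_trans yk' yL).
have e1 := hS _ _ Ox On (ltW xk) (lexx _).
have e2 := aff _ _ On Oy (lexx _) (ltW yk') yk.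
rewrite -(subrK (v (k%:R * h)) (v x)) -addrA.
apply: (le_trans (ler_normD _ _)); apply: lerD.
  apply: (le_trans e1); rewrite ler_wpM2l//; lra.
apply: (le_trans e2); rewrite ler_wpM2l//; lra.
Qed.

Lemma spaceV_lip : exists S,
  [/\ measurable_fun setT v, vanishes_outside Omega v, forall x, `|v x| <= S
    & forall x y, Omega x -> Omega y -> `|v x - v y| <= S * `|x - y|].
Proof.
have [S S0 hS] := lip_upto (leqnn _).
have [cv vv pv] := Vv.
have NL : N.+1%:R * h = L by rewrite /h mulrC divfK// pnatr_eq0.
have lip x y : Omega x -> Omega y -> `|v x - v y| <= S * `|x - y|.
  move=> Ox Oy; case: (leP x y) => xy.
    rewrite [`|x - y|]distrC [`|y - x|]ger0_norm ?subr_ge0//; apply: hS => //.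
    by rewrite NL; move: Oy; rewrite /= in_itv/= => /andP[_ /ltW].
  rewrite distrC [`|x - y|]gtr0_norm ?subr_gt0//; apply: hS => //; first exact: ltW.
  by rewrite NL; move: Ox; rewrite /= in_itv/= => /andP[_ /ltW].
have Oh : Omega (L / 2) by have Lp := L0; rewrite /= in_itv/=; apply/andP; split; lra.
have SL : 0 <= S * L by rewrite mulr_ge0// ltW.
(* One constant serves for both bounds: the value at the midpoint plus S L dominates v, and the last
   S keeps it above the Lipschitz constant. *)
exists (`|v (L / 2)| + S * L + S); split => //.
- have mO : measurable Omega by exact: measurable_itv.
  have oO : open Omega by exact: itv_open.
  have cO : {in Omega, continuous v} by move=> x /set_mem xO; apply: cv; rewrite inE.
  have mv := open_continuous_measurable_fun oO cO.
  have -> : v = v \_ Omega.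
    apply/funext => x; rewrite patchE; case: ifPn => // /negP hx.
    by apply: vv => Ox; apply: hx; exact/mem_set.
  exact: ((measurable_restrictT v mO).1 mv).
- move=> x; have [Ox|Ox] := pselect (Omega x); last first.
    by rewrite vv// normr0 !addr_ge0.
  rewrite -(subrK (v (L / 2)) (v x)).
  apply: (le_trans (ler_normD _ _)); have := lip _ _ Ox Oh.
  have : S * `|x - L / 2| <= S * L.
    rewrite ler_wpM2l// ler_norml; move: Ox; rewrite /= in_itv/= => /andP[? ?].
    by apply/andP; split; lra.
  lra.
- move=> x y Ox Oy; apply: (le_trans (lip _ _ Ox Oy)); rewrite ler_wpM2r//.
  by rewrite lerDr addr_ge0.
Qed.

End spaceV_lip.

End FE.

(** * Piecewise linear interpolation *)

Section Interp.
Context {R : realType}.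
Variables (h : R) (w : R -> R).
Hypothesis h0 : 0 < h.

(** Cells are indexed by all integers, so the interpolant lives on the whole line. When w vanishes
    outside Omega, the cells beyond the end points have zero increments. *)
Definition cell (x : R) : int := Num.floor (x / h).
Definition node (i : int) : R := i%:~R * h.
Definition node_incr (i : int) : R := w (node (i + 1)) - w (node i).
Definition interp (x : R) : R := w (node (cell x)) + node_incr (cell x) * (x / h - (cell x)%:~R).

Lemma cell_itv x : (cell x)%:~R <= x / h < (cell x)%:~R + 1.
Proof. by have := floor_itv (x / h); rewrite intrD. Qed.

Lemma nodeS i : node (i + 1) = node i + h.
Proof. by rewrite /node intrD mulrDl mul1r. Qed.

Lemma node_cell x : node (cell x) <= x < node (cell x) + h.
Proof.
have /andP[h1 h2] := cell_itv x.
rewrite /node -ler_pdivlMr// h1 /=.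
by rewrite -[X in _ + X]mul1r -mulrDl -ltr_pdivrMr.
Qed.

(** Points less than h apart lie in the same cell or in adjacent ones. In the second case the
    increment is split at the common node. *)
Lemma interp_lip x y S : x <= y -> y < x + h ->
  `|node_incr (cell x)| <= S -> `|node_incr (cell y)| <= S -> `|interp x - interp y| <= S * ((y - x) / h).
Proof.
move=> xy yx Sx Sy.
have /andP[x1 x2] := cell_itv x; have /andP[y1 y2] := cell_itv y.
have XY : x / h <= y / h by rewrite ler_pM2r// invr_gt0.
have YX : y / h < x / h + 1.
  by rewrite -[X in _ + X](@divff _ h) ?gt_eqF// -mulrDl ltr_pM2r// invr_gt0.
rewrite mulrBl; move: x1 x2 y1 y2 XY YX; rewrite /interp.
set X := x / h; set Y := y / h => x1 x2 y1 y2 XY YX.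
have : cell x <= cell y.
  by rewrite /cell floor_ge_int; apply: le_trans XY.
have : cell y <= cell x + 1.
  rewrite -ltzD1 -(ltr_int R) !intrD; lra.
move=> h1 h2.
have [e|e] := eqVneq (cell y) (cell x).
  rewrite e in Sy y1 y2 *.
  rewrite [X in `|X|](_ : _ = node_incr (cell x) * (X - Y)); last by ring.
  by rewrite normrM [`|X - Y|]distrC (ger0_norm (_ : 0 <= Y - X)) ?subr_ge0// ler_wpM2r// subr_ge0.
have e' : cell y = cell x + 1.
  apply/eqP; rewrite eq_le h1 /= lezD1.
  by rewrite lt_neqAle h2 andbT eq_sym.
have S0 : 0 <= S by exact: le_trans Sx.
have wy : w (node (cell y)) = w (node (cell x)) + node_incr (cell x) by rewrite e' /node_incr; ring.
rewrite wy.
set P := node_incr (cell x) in Sx *; set Q := node_incr (cell y) in Sy *.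
have -> : (cell y)%:~R = (cell x)%:~R + 1 :> R by rewrite e' intrD.
have yy : 0 <= Y - ((cell x)%:~R + 1) by rewrite subr_ge0; move: y1; rewrite e' intrD.
set i := (cell x)%:~R in x1 x2 yy *.
rewrite [X in `|X|](_ : _ = - (P * (i + 1 - X) + Q * (Y - (i + 1)))); last by ring.
rewrite normrN; apply: (le_trans (ler_normD _ _)); rewrite !normrM.
rewrite (ger0_norm yy) (ger0_norm (_ : 0 <= i + 1 - X)); last by lra.
have z1 : `|P| * (i + 1 - X) <= S * (i + 1 - X) by rewrite ler_wpM2r//; lra.
have z2 : `|Q| * (Y - (i + 1)) <= S * (Y - (i + 1)) by rewrite ler_wpM2r.
have -> : S * (Y - X) = S * (i + 1 - X) + S * (Y - (i + 1)) by ring.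
exact: lerD.
Qed.

(** The interpolant is a convex combination of the two nodal values. *)
Lemma interp_err x E : `|w (node (cell x)) - w x| <= E -> `|w (node (cell x + 1)) - w x| <= E ->
  `|w x - interp x| <= E.
Proof.
move=> e1 e2; have /andP[x1 x2] := cell_itv x.
rewrite /interp; set s := _ - _%:~R.
have s0 : 0 <= s by rewrite subr_ge0.
have s1 : 0 <= 1 - s by rewrite /s; lra.
rewrite distrC [X in `|X|](_ : _ = (1 - s) * (w (node (cell x)) - w x) +
  s * (w (node (cell x + 1)) - w x)); last by rewrite /node_incr; ring.
apply: (le_trans (ler_normD _ _)); rewrite !normrM (ger0_norm s0) (ger0_norm s1).
have z1 := ler_wpM2l s1 e1; have z2 := ler_wpM2l s0 e2.
apply: (le_trans (lerD z1 z2)); rewrite -mulrDl subrK mul1r//.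
Qed.

Lemma node_dist x : `|x - node (cell x)| <= h /\ `|x - node (cell x + 1)| <= h.
Proof.
have /andP[h1 h2] := node_cell x; rewrite nodeS; have hp := h0.
split; rewrite ler_norml; apply/andP; split; lra.
Qed.

Lemma node_incr_le x E : `|w (node (cell x)) - w x| <= E -> `|w (node (cell x + 1)) - w x| <= E ->
  `|node_incr (cell x)| <= 2 * E.
Proof.
move=> e1 e2; rewrite /node_incr -(subrKA (w x)).
apply: (le_trans (ler_normD _ _)); rewrite [X in _ + X]distrC; lra.
Qed.

End Interp.

Section InterpV.
Context {R : realType}.
Local Notation mu := (@lebesgue_measure R).
Local Notation mu2 := (mu \x mu)%E.
Variables (L al : R).
Hypotheses (L0 : 0 < L) (al0 : 0 < al).
Local Notation Omega := (`]0, L[%classic : set R).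
Local Notation a := (1 + al).
Local Notation odist := (odist L).
Local Notation bweight := (bweight L).
Variables (N : nat) (M : R) (w : R -> R).
Variable h : R.
Hypothesis hE : h = L / N.+1%:R.
Hypothesis Xw : Xbound L al M w.

Local Notation cell := (cell h).
Local Notation node := (node h).
Local Notation node_incr := (node_incr h w).
Local Notation interp := (interp h w).

Let a0 : 0 <= a. Proof. by have := al0; lra. Qed.
Let h0 : 0 < h. Proof. by rewrite hE divr_gt0. Qed.
Let hL : N.+1%:R * h = L. Proof. by rewrite hE mulrC divfK// pnatr_eq0. Qed.
Let M0 : 0 <= M. Proof. exact: (Xbound_ge0 Xw). Qed.
Let vw : vanishes_outside Omega w. Proof. by have [] := Xw. Qed.

Lemma notO_le x : x <= 0 -> ~ Omega x.
Proof. by move=> x0; rewrite /= in_itv/= ltNge x0. Qed.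

Lemma notO_ge x : L <= x -> ~ Omega x.
Proof. by move=> x0; rewrite /= in_itv/= [x < L]ltNge x0 andbF. Qed.

Lemma node_incr_left x : x < 0 -> node_incr (cell x) = 0.
Proof.
move=> x0.
have f0 : cell x < 0 by rewrite /cell floor_lt0 ltr_pdivrMr// mul0r.
rewrite /node_incr !vw ?subr0//; apply: notO_le; rewrite /node pmulr_lle0// lerz0.
- exact: ltW.
- by rewrite lezD1.
Qed.

Lemma cell_right x : L <= x -> (N.+1 : int) <= cell x.
Proof.
move=> xL; rewrite /cell floor_ge_int ler_pdivlMr//.
by rewrite -[_%:~R]/(N.+1%:R) hL.
Qed.

Lemma node_incr_right x : L <= x -> node_incr (cell x) = 0.
Proof.
move=> /cell_right xL.
have xL' : N.+1%:R <= (cell x)%:~R :> R by rewrite -[N.+1%:R]/((N.+1 : int)%:~R) ler_int.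
rewrite /node_incr !vw ?subr0//; apply: notO_ge; rewrite /node -[leLHS]hL ler_pM2r//.
by rewrite intrD; lra.
Qed.

Lemma interp_out : vanishes_outside Omega interp.
Proof.
move=> x Ox; rewrite /interp.
case: (ltrgt0P x) => x0.
- have xL : L <= x by rewrite leNgt; apply/negP => xL; apply: Ox; rewrite /= in_itv/= x0.
  rewrite node_incr_right// mul0r addr0; apply: vw; apply: notO_ge.
  have := cell_right xL => xL'.
  rewrite /node -[leLHS]hL ler_pM2r//.
  by rewrite -[N.+1%:R]/((N.+1 : int)%:~R) ler_int.
- rewrite node_incr_left// mul0r addr0; apply: vw; apply: notO_le.
  by have /andP[h1 _] := node_cell h0 x; apply: le_trans h1 _; exact: ltW.
- have f0 : cell x = 0 by rewrite /cell x0 mul0r floor0.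
  rewrite f0 x0 mul0r subr0 mulr0 addr0 /node mul0r; apply: vw; exact: notO_le.
Qed.

Definition interp_bound (x : R) := M * (ellp a h * bweight x).

Lemma interp_bound_ge0 x : 0 <= interp_bound x.
Proof. by apply: mulr_ge0 => //; apply: mulr_ge0; [exact: ellp_ge0|exact: bweight_ge0]. Qed.

(* At distance at least 2h from the boundary the interior modulus applies; closer
   to it, the global modulus is absorbed by the weight, ell(h)^-1 being at most
   ell(odist x / 2)^-1. *)
Lemma osc_le_interp_bound x y : Omega x -> `|x - y| <= h -> `|w y - w x| <= interp_bound x.
Proof.
move=> Ox xy; have [_ w1 w2] := Xw.
have x0 : 0 < odist x by exact/OmegaP.
have [->|ne] := eqVneq y x; first by rewrite subrr normr0 interp_bound_ge0.
have t0 : 0 < `|x - y| by rewrite normr_gt0 subr_eq0 eq_sym.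
rewrite distrC; have hp := h0.
case: (ltP (odist x) (2 * h)) => d.
  apply: (le_trans (w1 x y)); rewrite ler_wpM2l//.
  apply: (le_trans (ellp_mono (ltW al0) t0 xy)).
  rewrite (ellp_S al h0) mulrC ler_wpM2l ?ellp_ge0// bweight_in//.
  apply: (@le_trans _ _ (ellV (odist x / 2))); first by apply: ellV_anti; lra.
  by rewrite expr2 ler_peMl ?normr_ge0// ellV_ge1//; lra.
have yd : odist x / 2 <= odist y.
  have y1 : odist x - h <= odist y; last by lra.
  move: xy; rewrite ler_norml => /andP[q1 q2].
  have p1 : odist x <= x by rewrite ge_min lexx.
  have p2 : odist x <= L - x by rewrite ge_min lexx orbT.
  rewrite le_odist; apply/andP; split; lra.
have Oy : Omega y by apply/OmegaP; lra.
apply: (le_trans (w2 x y Ox Oy)); rewrite ler_wpM2l// bweight_in//.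
apply: ler_pM; rewrite ?ellp_ge0 ?sqr_ge0//; first exact: ellp_mono.
apply: lerXn2r; rewrite ?nnegrE ?normr_ge0//; apply: ellV_anti; first lra.
by rewrite le_min yd andbT; lra.
Qed.

Lemma interp_err_le x : `|w x - interp x| <= interp_bound x.
Proof.
have [Ox|Ox] := pselect (Omega x); last first.
  by rewrite (vw Ox) (interp_out Ox) subr0 normr0 interp_bound_ge0.
have [n1 n2] := node_dist h0 x.
by apply: interp_err; exact: osc_le_interp_bound.
Qed.

Lemma node_incr_in x : Omega x -> `|node_incr (cell x)| <= 2 * interp_bound x.
Proof.
move=> Ox; have [n1 n2] := node_dist h0 x.
by apply: node_incr_le; exact: osc_le_interp_bound.
Qed.

Lemma interp_lipE x y : `|x - y| < h ->
  `|interp x - interp y| <= 2 * (interp_bound x + interp_bound y) * (`|x - y| / h).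
Proof.
wlog xy : x y / x <= y.
  move=> H; case: (leP x y) => [|/ltW] xy; first exact: H.
  by rewrite distrC => /(H _ _ xy); rewrite [interp_bound y + _]addrC [`|interp y - _|]distrC.
have E1 := interp_bound_ge0 x; have E2 := interp_bound_ge0 y; have hp := h0.
have S0 : 0 <= 2 * (interp_bound x + interp_bound y) by rewrite mulr_ge0// addr_ge0.
rewrite [`|x - y|]distrC (ger0_norm (_ : 0 <= y - x)) ?subr_ge0// => yx.
have R0 : 0 <= 2 * (interp_bound x + interp_bound y) * ((y - x) / h).
  by rewrite mulr_ge0// mulr_ge0 ?subr_ge0// invr_ge0 ltW.
have [Oxy|/not_orP[nx ny]] := pselect (Omega x \/ Omega y); last first.
  by rewrite (interp_out nx) (interp_out ny) subr0 normr0.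
have yx' : y < x + h by lra.
have hLe : h <= L by rewrite hE ler_pdivrMr// ler_peMr ?ler1n// ltW.
have [Oy|Oy] := pselect (Omega y).
  have dy : `|node_incr (cell y)| <= 2 * (interp_bound x + interp_bound y).
    by apply: (le_trans (node_incr_in Oy)); lra.
  apply: interp_lip => //.
  have [Ox|Ox] := pselect (Omega x); first by apply: (le_trans (node_incr_in Ox)); lra.
  case: (ltrgt0P x) => x0.
  - exfalso; apply: Ox; move: Oy; rewrite /= !in_itv/= x0 => /andP[_ yL].
    exact: le_lt_trans yL.
  - by rewrite node_incr_left// normr0.
  (* The end point 0 is outside Omega but belongs to cell 0, which also contains y. *)
  - have -> : cell x = cell y => //.
    rewrite x0 /cell mul0r floor0; apply/esym/eqP; rewrite floor_eq.
    rewrite divr_ge0 ?ltW//=; last by move: Oy; rewrite /= in_itv/= => /andP[].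
    by rewrite add0r ltr_pdivrMr// mul1r; move: yx'; rewrite x0 add0r.
have Ox : Omega x by case: Oxy.
apply: interp_lip => //; first by apply: (le_trans (node_incr_in Ox)); lra.
(* Here y lies at or beyond L, in a cell with zero increment. *)
rewrite node_incr_right ?normr0//.
rewrite leNgt; apply/negP => yL; apply: Oy; move: Ox; rewrite /= !in_itv/= yL andbT => /andP[x0 _].
exact: lt_le_trans xy.
Qed.

Lemma interp_spaceV : spaceV L N interp.
Proof.
have hp := h0.
rewrite /spaceV -hE; split.
- move=> x _; apply/cvgrPdist_lt => e e0.
  have [_ _ bw _] := Xbound_logreg al0 Xw.
  have M2 : 0 <= 2 * M by rewrite mulr_ge0.
  (* Every slope is at most 2 M / h; the added 1 keeps the constant invertible when M = 0. *)
  have K0 : 0 < (2 * M + 1) / h by rewrite divr_gt0//; lra.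
  near=> y.
  have dM z : `|node_incr (cell z)| <= 2 * M.
    apply: (le_trans (ler_normB _ _)).
    by have := bw (node (cell z + 1)); have := bw (node (cell z)); lra.
  have yh : `|x - y| < h by near: y; apply/nbhs_ballP; exists h => //= z.
  have ye : `|x - y| < e / ((2 * M + 1) / h).
    by near: y; apply/nbhs_ballP; exists (e / ((2 * M + 1) / h)) => //=; exact: divr_gt0.
  have le1 : `|interp x - interp y| <= 2 * M * (`|x - y| / h).
    case: (leP x y) => xy.
      rewrite [`|x - y|]distrC (ger0_norm (_ : 0 <= y - x)) ?subr_ge0//.
      apply: interp_lip => //; move: yh; rewrite ltr_norml => /andP[]; lra.
    rewrite distrC (gtr0_norm (_ : 0 < x - y)) ?subr_gt0//.
    apply: interp_lip => //; first exact: ltW.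
    move: yh; rewrite ltr_norml => /andP[]; lra.
  apply: (le_lt_trans le1).
  rewrite ltr_pdivlMr// in ye; apply: le_lt_trans ye.
  rewrite [leRHS](_ : _ = (2 * M + 1) * (`|x - y| / h)); last by ring.
  by rewrite ler_wpM2r ?mulr_ge0 ?invr_ge0 ?(ltW h0)//; lra.
- exact: interp_out.
- move=> i iN.
  pose c1 := node_incr i / h; pose c0 := w (node i) - node_incr i * i%:R.
  exists (c0%:P + c1 *: 'X).
    by rewrite (leq_trans (size_polyD _ _))// geq_max (leq_trans (size_polyC_leq1 _))//=
      (leq_trans (size_scale_leq _ _))// size_polyX.
  move=> x; rewrite in_itv/= => /andP[x1 x2].
  rewrite hornerD hornerC hornerZ hornerX.
  have fx : cell x = i.
    apply/eqP; rewrite /cell floor_eq intrD.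
    rewrite ler_pdivlMr// ltr_pdivrMr//= (ltW x1) /=.
    by move: x2; rewrite -[i.+1]addn1 natrD.
  rewrite /interp fx /c0 /c1 -[(i : int)%:~R]/(i%:R : R); field.
  by rewrite gt_eqF.
Unshelve. all: by end_near. Qed.

End InterpV.

(** * Energy of the interpolation error *)

Section PairBounds.
Context {R : realFieldType}.

Lemma sqrB_le (x y X Y : R) : x ^+ 2 <= X -> y ^+ 2 <= Y ->
  (x - y) ^+ 2 <= 2 * (X + Y).
Proof. by move=> xX yY; have := sqr_ge0 (x + y); lra. Qed.

Variables (k q eh el M a b : R).
Hypotheses (k0 : 0 <= k) (eh0 : 0 < eh) (ehl : eh <= el) (q0 : 0 <= q).

(** Here k is [nearker], q is [logker], eh and el are [ellp (1 + al) h] and [ellp al h], and a, b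
    are the weights at the two points. For pairs at distance at least h, k <= q / eh while the
    squared errors carry eh^2, so one factor eh <= el survives. *)
Lemma far_pair_le (x y : R) : k <= q / eh ->
  x ^+ 2 <= M ^+ 2 * eh ^+ 2 * a ^+ 2 -> y ^+ 2 <= M ^+ 2 * eh ^+ 2 * b ^+ 2 ->
  k * (x - y) ^+ 2 <= 18 * M ^+ 2 * el * ((a ^+ 2 + b ^+ 2) * q).
Proof.
move=> kq xa yb.
have xy : (x - y) ^+ 2 <= 2 * (M ^+ 2 * eh ^+ 2 * (a ^+ 2 + b ^+ 2)).
  by rewrite mulrDr; exact: sqrB_le.
apply: (@le_trans _ _ (q / eh * (2 * (M ^+ 2 * eh ^+ 2 * (a ^+ 2 + b ^+ 2))))).
  by apply: ler_pM => //; exact: sqr_ge0.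
rewrite [leLHS](_ : _ = 2 * (M ^+ 2 * ((a ^+ 2 + b ^+ 2) * q)) * eh); last first.
  by field; rewrite gt_eqF.
rewrite [leRHS](_ : _ = 2 * (M ^+ 2 * ((a ^+ 2 + b ^+ 2) * q)) * (9 * el)); last by ring.
apply: ler_wpM2l; last by have e0 := eh0; have el' := ehl; lra.
apply: mulr_ge0 => //; apply: mulr_ge0; first exact: sqr_ge0.
by apply: mulr_ge0 => //; apply: addr_ge0; exact: sqr_ge0.
Qed.

(** For pairs closer than h, x is the increment of w and y that of the interpolant. In k x^2 one
    factor uses the kernel bound and the other is at most M el; in k y^2 the linear factor r cancels
    the singularity 1 / et. The constant 18 is 2 (1 + 8). *)
Lemma near_pair_le (et r x y : R) : k = q / et -> 0 < et -> 0 <= M ->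
  a <= a ^+ 2 -> b <= b ^+ 2 ->
  k * `|x| <= M * ((a + b) * q) -> `|x| <= M * el ->
  `|y| <= 2 * (M * (eh * a) + M * (eh * b)) * r -> 0 <= r -> r ^+ 2 <= et / eh ->
  k * (x - y) ^+ 2 <= 18 * M ^+ 2 * el * ((a ^+ 2 + b ^+ 2) * q).
Proof.
move=> kE et0 M0 aa bb kx xM yr r0 re.
have el0 := lt_le_trans eh0 ehl.
have a2 := sqr_ge0 a; have b2 := sqr_ge0 b; have M2 := sqr_ge0 M.
set S := a ^+ 2 + b ^+ 2; have S0 : 0 <= S by exact: addr_ge0.
have Sq : 0 <= M ^+ 2 * (S * q) by exact: (mulr_ge0 M2 (mulr_ge0 S0 q0)).
have dx : k * x ^+ 2 <= M ^+ 2 * (S * q) * el.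
  have -> : k * x ^+ 2 = k * `|x| * `|x| by rewrite -mulrA -expr2 real_normK ?num_real.
  apply: (@le_trans _ _ (M * ((a + b) * q) * (M * el))).
    by apply: ler_pM; [exact: (mulr_ge0 k0)|exact: normr_ge0|exact: kx|exact: xM].
  rewrite [leLHS](_ : _ = M ^+ 2 * el * q * (a + b)); last by ring.
  rewrite [leRHS](_ : _ = M ^+ 2 * el * q * S); last by ring.
  apply: ler_wpM2l; last exact: lerD.
  by apply: mulr_ge0 => //; apply: mulr_ge0 => //; exact: ltW.
have dy : k * y ^+ 2 <= 8 * (M ^+ 2 * (S * q)) * el.
  rewrite -(real_normK (num_real y)).
  apply: (@le_trans _ _ (k * (8 * M ^+ 2 * eh ^+ 2 * S * (et / eh)))).
    apply: ler_wpM2l => //.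
    apply: (@le_trans _ _ ((2 * (M * (eh * a) + M * (eh * b)) * r) ^+ 2)).
      by apply: lerXn2r; rewrite ?nnegrE//; exact: le_trans yr.
    rewrite exprMn; apply: ler_pM; [exact: sqr_ge0|exact: sqr_ge0| |exact: re].
    rewrite [leLHS](_ : _ = 4 * (M ^+ 2 * eh ^+ 2) * (a + b) ^+ 2); last by ring.
    rewrite [leRHS](_ : _ = 4 * (M ^+ 2 * eh ^+ 2) * (2 * S)); last by ring.
    apply: ler_wpM2l.
      by apply: mulr_ge0 => //; apply: mulr_ge0; exact: sqr_ge0.
    by have := sqr_ge0 (a - b); rewrite /S; lra.
  rewrite kE [leLHS](_ : _ = 8 * (M ^+ 2 * (S * q)) * eh); last first.
    by field; rewrite !gt_eqF.
  by apply: ler_wpM2l => //; exact: mulr_ge0.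
have : k * (x - y) ^+ 2 <= 2 * (k * x ^+ 2) + 2 * (k * y ^+ 2).
  rewrite [leRHS](_ : _ = k * (2 * x ^+ 2 + 2 * y ^+ 2)); last by ring.
  by apply: ler_wpM2l => //; rewrite -mulrDr; exact: sqrB_le.
rewrite [18 * _ * _ * _](_ : _ = 18 * (M ^+ 2 * (S * q) * el)); last by ring.
have := mulr_ge0 Sq (ltW el0); lra.
Qed.

End PairBounds.

Section InterpEst.
Context {R : realType}.
Local Notation mu := (@lebesgue_measure R).
Local Notation mu2 := (mu \x mu)%E.
Variables (L al : R).
Hypotheses (L0 : 0 < L) (al0 : 0 < al) (al1 : al < 1).
Local Notation Omega := (`]0, L[%classic : set R).
Local Notation a := (1 + al).
Local Notation bweight := (bweight L).
Local Notation pairweight := (pairweight L a).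

Let a1 : 1 < a. Proof. by rewrite ltrDl. Qed.
Let a2 : a <= 2. Proof. by have := al1; lra. Qed.
Let a0 : 0 <= a. Proof. by have := al0; lra. Qed.

Lemma spaceV_inH N (v : R -> R) : spaceV L N v -> inH L v.
Proof.
move=> /(spaceV_lip L0)[S [mv vv bv lv]].
by have := lip_logreg al1 mv vv bv lv; exact: logreg_inH.
Qed.

Lemma Xbound_inH M (w : R -> R) : Xbound L al M w -> inH L w.
Proof. by move=> Xw; exact: (logreg_inH L0 a1 a2 (Xbound_logreg al0 Xw)). Qed.

(** As t / h <= 1 and a <= 2, the square is at most the a-th power, and [ellV_scale] bounds the
    base. *)
Lemma ellp_ratio t h : 0 < t -> t <= h -> h <= 10^-1 ->
  (t / h) ^+ 2 <= ellp a t / ellp a h.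
Proof.
move=> t0 th h1; have h0 := lt_le_trans t0 th.
have Lt := ellV_gt0 t0; have Lh := ellV_gt0 h0.
have th1 : 0 < t / h by rewrite divr_gt0.
have th2 : t / h <= 1 by rewrite ler_pdivrMr// mul1r.
have e1 : (t / h) <= ell t / ell h.
  have := ler_wpM2l (ltW th1) (ellV_scale t0 th h1).
  rewrite mulrA (_ : t / h * (h / t) = 1); last by field; rewrite !gt_eqF.
  by rewrite mul1r !ell_ellV invrK => H; rewrite [leRHS]mulrC ler_pdivlMr.
apply: (@le_trans _ _ ((t / h) `^ a)).
  rewrite -powR_mulrn; last exact: ltW.
  by apply: ger_powR => //; apply/andP.
have -> : ellp a t / ellp a h = (ell t / ell h) `^ a.
  have eh := ltW (ell_gt0 h0); have et := ltW (ell_gt0 t0).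
  have hV : (ell h)^-1 `^ a = (ell h `^ a)^-1.
    by rewrite -(powR_inv1 eh) -powRrM mulN1r powRN.
  by rewrite /ellp powRM ?invr_ge0// hV.
by apply: ge0_ler_powR => //; rewrite nnegrE ?(ltW th1)// (le_trans (ltW th1)).
Qed.

Section one.
Variables (N : nat) (M : R) (w : R -> R) (h : R).
Hypothesis hE : h = L / N.+1%:R.
Hypothesis Xw : Xbound L al M w.
Hypothesis h10 : h <= 10^-1.
Local Notation interp := (interp h w).
Let phi x := w x - interp x.
Let M0 : 0 <= M. Proof. exact: (Xbound_ge0 Xw). Qed.
Let h0 : 0 < h. Proof. by rewrite hE divr_gt0. Qed.

Let e0 := ellp_gt0 a h0.
Let e1 := ellp_gt0 al h0.
Let e2 : ellp a h <= ellp al h.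
Proof. by rewrite (ellp_S al h0) ler_peMl ?ellp_ge0// ellV_ge1. Qed.

Let e3 : ellp a h <= 1. Proof. exact: ellp_le1. Qed.

Let phi_le x : phi x ^+ 2 <= M ^+ 2 * ellp a h ^+ 2 * bweight x ^+ 2.
Proof.
rewrite -!exprMn -(real_normK (num_real (phi x))) -mulrA.
apply: lerXn2r; rewrite ?nnegrE//; first exact: (interp_bound_ge0 h Xw x).
exact: (interp_err_le L0 al0 hE Xw).
Qed.

Let near_phi p : nearker p * (phi p.1 - phi p.2) ^+ 2 <= 18 * M ^+ 2 * ellp al h * pairweight p.
Proof.
have k0 := nearker_ge0 p; have q0 := logker_ge0 a (p.1 - p.2).
have [e|ne] := eqVneq p.1 p.2.
  rewrite e subrr expr0n mulr0; apply: mulr_ge0; last exact: pairweight_ge0.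
  by apply: mulr_ge0; [apply: mulr_ge0 => //; exact: sqr_ge0|exact: ellp_ge0].
have t0 : 0 < `|p.1 - p.2| by rewrite normr_gt0 subr_eq0.
have knk := nearkerE al ne; have et := ellp_gt0 a t0.
have -> : pairweight p = (bweight p.1 ^+ 2 + bweight p.2 ^+ 2) * logker a (p.1 - p.2) by [].
case: (leP h `|p.1 - p.2|) => th.
  apply: (far_pair_le k0 e0 e2 q0 _ (phi_le p.1) (phi_le p.2)).
  rewrite knk; apply: ler_wpM2l; first exact: q0.
  by rewrite (lef_pV2 et e0); exact: (ellp_mono a0 h0 th).
have [_ _ _ kw] := Xbound_logreg al0 Xw; have [_ w1 _] := Xw.
have -> : phi p.1 - phi p.2 = (w p.1 - w p.2) - (interp p.1 - interp p.2).
  by rewrite /phi; ring.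
apply: (near_pair_le k0 e0 e2 q0 knk et M0 (bweight_le_sqr L p.1) (bweight_le_sqr L p.2)
  (kw p) _ (interp_lipE L0 al0 hE Xw th)).
- apply: (le_trans (w1 _ _)); apply: ler_wpM2l; first exact: M0.
  by apply: ellp_mono; [exact: ltW|exact: t0|exact: ltW].
- by apply: mulr_ge0; [exact: normr_ge0|rewrite invr_ge0; exact: ltW].
- by apply: ellp_ratio; [exact: t0|exact: ltW|exact: h10].
Qed.

Lemma interp_one : energy phi + L2sq phi <=
  (18 * (\int[mu2]_p pairweight p) + \int[mu]_x (bweight x ^+ 2)) * (M ^+ 2 * ellp al h).
Proof.
have iD := pairweight_integrable L0 a1 a2; have iD2 := bweight_sqr_integrable L0 a1 a2.
have [_ p2 pD _] : inH L phi.
  by apply: inH_sub; [exact: Xbound_inH Xw|apply: spaceV_inH; exact: (interp_spaceV L0 al0 hE Xw)].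
rewrite mulrDl; apply: lerD.
  rewrite [leRHS](_ : _ = 18 * M ^+ 2 * ellp al h * \int[mu2]_p pairweight p); last by ring.
  rewrite /energy -RintegralZl//; apply: le_Rintegral => //; exact: integrable_ZR.
rewrite mulrC /L2sq -RintegralZl//; apply: le_Rintegral => //; first exact: integrable_ZR.
move=> x _; apply: (le_trans (phi_le x)); rewrite ler_wpM2r ?sqr_ge0//.
rewrite ler_wpM2l ?sqr_ge0//; apply: le_trans e2.
by rewrite expr2 ler_piMl// ellp_ge0.
Qed.

End one.

Lemma interpolation : exists2 C : R, 0 <= C & forall N M w h,
  h = L / N.+1%:R -> h <= 10^-1 -> Xbound L al M w ->
  exists2 v, spaceV L N v &
    energy (fun x => w x - v x) + L2sq (fun x => w x - v x) <= C * (M ^+ 2 * ellp al h).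
Proof.
exists (18 * (\int[mu2]_p pairweight p) + \int[mu]_x (bweight x ^+ 2)).
  apply: addr_ge0; last by apply: Rintegral_ge0 => x _; exact: sqr_ge0.
  by rewrite mulr_ge0//; apply: Rintegral_ge0 => x _; exact: pairweight_ge0.
move=> N M w h hE h10 Xw; exists (interp h w).
  exact: (interp_spaceV L0 al0 hE Xw).
exact: (interp_one hE Xw h10).
Qed.

End InterpEst.

(** * Mollification *)

Section Kernel.
Context {R : realType}.
Local Notation mu := (@lebesgue_measure R).
Local Notation mu2 := (mu \x mu)%E.

(** [A] bounds both the size and the Lipschitz constant of k. The comparison with 1/|t| excludes t =
    0, where the inverse is 0 by convention while k may be positive. *)
Definition mollifier (k : R -> R) (A : R) :=
  [/\ mu.-integrable setT (EFin \o k), forall t, k (- t) = k t,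
      forall t, 0 <= k t <= A,
      forall t, t != 0 -> k t <= (if `|t| < 1 then `|t|^-1 else 0)
    & forall s t, `|k s - k t| <= A * `|s - t|].

Lemma invr_sub_integral (d : R) : 0 < d -> d < 1 ->
  (\int[mu]_(t in `[d, 1%R]) (t^-1 - 1)%:E = (- ln d - (1 - d))%:E)%E.
Proof.
move=> d0 d1.
have dF (x : R) : 0 < x -> is_derive x 1 (fun t : R => ln t - t) (x^-1 - 1).
  move=> x0; have := is_derive1_ln x0 => h.
  by apply: is_deriveB.
have inb (x : R) : x \in `[d, 1] -> 0 < x.
  by rewrite in_itv/= => /andP[h _]; exact: lt_le_trans h.
have dc (x : R) : x \in `[d, 1] -> derivable (fun t : R => ln t - t) x 1.
  by move=> /inb x0; have [] := dF _ x0.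
have cF (x : R) : x \in `[d, 1] -> (fun t : R => ln t - t) @ x --> ln x - x.
  move=> /dc h; apply: (@differentiable_continuous _ _ _ x (fun t : R => ln t - t)).
  by rewrite -derivable1_diffP.
rewrite (@continuous_FTC2 _ (fun t => t^-1 - 1) (fun t => ln t - t))//.
- by rewrite ln1 -EFinB; congr EFin; ring.
- apply: continuous_in_subspaceT => x /set_mem /inb x0.
  by apply: continuousB; [apply: continuousV => //; rewrite gt_eqF|exact: cvg_cst].
- split.
  + move=> x; rewrite in_itv/= => /andP[h1 h2]; apply: dc.
    by rewrite in_itv/= !ltW.
  + by apply: cvg_at_right_filter; apply: cF; rewrite in_itv/= lexx ltW.
  + by apply: cvg_at_left_filter; apply: cF; rewrite in_itv/= lexx ltW.
- move=> x; rewrite in_itv/= => /andP[h1 h2]; rewrite derive1E.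
  by have [_ ->] := dF x (lt_trans d0 h1).
Qed.

Lemma maxr_lip (a b c : R) : `|Num.max a c - Num.max b c| <= `|a - b|.
Proof.
have h1 := ler_norm (a - b); have h2 := ler_norm (b - a); rewrite distrC in h2.
have h3 := normr_ge0 (a - b).
by rewrite ler_norml !maxElt; case: ifP => ac; case: ifP => bc; apply/andP; split;
  move/negbT: ac || idtac; move/negbT: bc || idtac; rewrite -?leNgt; move=> *; lra.
Qed.

(** Truncating 1/|t| at height 1/d and subtracting 1 makes it Lipschitz and zero from |t| = 1 on,
    while its mass still grows like -ln d. *)
Lemma mollifier_exists (Q : R) : 0 < Q ->
  exists k A, [/\ 0 < A, mollifier k A & Q <= \int[mu]_x k x].
Proof.
(* With this d the integral over [d, 1] is -ln d - (1 - d) = Q + d. *)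
move=> Q0; pose d := expR (- (Q + 1)).
have d0 : 0 < d by exact: expR_gt0.
have d1 : d < 1 by rewrite -[ltRHS]expR0 ltr_expR; lra.
have di1 : 1 < d^-1 by rewrite -[ltLHS]invr1 ltf_pV2 ?posrE.
pose k (t : R) : R := Num.max (`|t|^-1 - 1) 0.
pose kd (t : R) : R := Num.max ((Num.max `|t| d)^-1 - 1) 0.
have m0 t : 0 < Num.max `|t| d by rewrite lt_max d0 orbT.
have k0 t : 0 <= kd t by rewrite le_max lexx orbT.
have kA t : kd t <= d^-1.
  rewrite ge_max invr_ge0 (ltW d0) andbT.
  have : (Num.max `|t| d)^-1 <= d^-1 by rewrite lef_pV2 ?posrE// le_max lexx orbT.
  lra.
have kout t : 1 <= `|t| -> kd t = 0.
  move=> t1; apply/max_r; rewrite subr_le0 invf_le1// le_max t1//.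
have lip s t : `|kd s - kd t| <= d^-1 ^+ 2 * `|s - t|.
  apply: (le_trans (maxr_lip _ _ _)).
  set a := Num.max `|s| d; set b := Num.max `|t| d.
  have ab : `|a - b| <= `|s - t|.
    by apply: (le_trans (maxr_lip _ _ _)); exact: ler_dist_dist.
  have a0 : 0 < a by exact: m0. have b0 : 0 < b by exact: m0.
  rewrite [X in `|X|](_ : _ = a^-1 * b^-1 * (b - a)); last first.
    by field; rewrite !gt_eqF.
  rewrite normrM [`|b - a|]distrC ger0_norm ?mulr_ge0 ?invr_ge0 ?(ltW a0) ?(ltW b0)//.
  apply: ler_pM => //; first by rewrite mulr_ge0 ?invr_ge0 ?(ltW a0) ?(ltW b0).
  rewrite expr2; apply: ler_pM; rewrite ?invr_ge0 ?(ltW a0) ?(ltW b0)// lef_pV2 ?posrE//;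
    by rewrite le_max lexx orbT.
have mk : measurable_fun setT kd.
  apply: continuous_measurable_fun => x; apply/cvgrPdist_lt => e e0.
  near=> y.
  apply: (le_lt_trans (lip x y)).
  rewrite -ltr_pdivlMl ?exprn_gt0 ?invr_gt0//.
  near: y; apply/nbhs_ballP; exists ((d^-1 ^+ 2)^-1 * e) => //=.
  by rewrite mulr_gt0 ?invr_gt0 ?exprn_gt0 ?invr_gt0.
have ki : mu.-integrable setT (EFin \o kd).
  have i1 : mu.-integrable setT (EFin \o (fun x => d^-1 * \1_(`]-1, 1[%classic : set R) x)).
    by apply: integrable_ZR; exact: integrable_indic_itv.
  apply: (le_integrableR _ _ i1); first exact: mk.
  move=> t; rewrite ger0_norm//.
  case: (ltP `|t| 1) => t1; last by rewrite kout// mulr_ge0 ?invr_ge0 ?(ltW d0)// indicE.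
  by rewrite indicE mem_set/= ?mulr1// in_itv/=; move: t1; rewrite ltr_norml.
have A0 : 0 < d^-1 ^+ 2 by rewrite exprn_gt0// invr_gt0.
exists kd, (d^-1 ^+ 2); split => //.
- split => //.
  + by move=> t; rewrite /kd normrN.
  + move=> t; rewrite k0 /=; apply: (le_trans (kA t)).
    by rewrite expr2 ler_peMr ?invr_ge0 ?(ltW d0)// ltW.
  + move=> t tn; case: ifP => t1; last by rewrite kout// leNgt t1.
    have t0 : 0 < `|t| by rewrite normr_gt0.
    rewrite ge_max invr_ge0 normr_ge0 andbT.
    have : (Num.max `|t| d)^-1 <= `|t|^-1 by rewrite lef_pV2 ?posrE// le_max lexx.
    lra.
- rewrite -lee_fin EFin_Rintegral//.
  have e1 : (\int[mu]_(t in `[d, 1%R]) (kd t)%:E <= \int[mu]_x (kd x)%:E)%E.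
    apply: ge0_subset_integral => //; first exact/measurable_EFinP.
    by move=> x _; rewrite lee_fin.
  apply: le_trans e1.
  rewrite (_ : (\int[mu]_(t in _) _)%E = (\int[mu]_(t in `[d, 1%R]) (t^-1 - 1)%:E)%E).
    have ld : ln d = - (Q + 1) by rewrite /d expRK.
    rewrite invr_sub_integral// lee_fin ld; lra.
  apply: eq_integral => t; rewrite inE/= in_itv/= => /andP[h1 h2]; congr EFin.
  have t0 : 0 < t by exact: lt_le_trans h1.
  rewrite /kd gtr0_norm// max_l; last first.
    by rewrite subr_ge0 invf_ge1 // max_l.
  by rewrite max_l.
Unshelve. all: by end_near. Qed.

End Kernel.

Section Mollify.
Context {R : realType}.
Local Notation mu := (@lebesgue_measure R).
Local Notation mu2 := (mu \x mu)%E.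
Variables (L : R) (k : R -> R) (A : R) (e : R -> R).
Hypotheses (L0 : 0 < L) (A0 : 0 < A) (kA : mollifier k A) (eH : inH L e).
Local Notation Omega := (`]0, L[%classic : set R).

Definition L1norm : R := \int[mu]_x `|e x|.
Definition mollify (x : R) : R := \int[mu]_z (k (x - z) * e z).

Let me_ : measurable_fun setT e. Proof. by have [] := eH. Qed.
Let mk : measurable_fun setT k.
Proof. by have [ki _ _ _ _] := kA; exact: measurable_integrableR ki. Qed.

Lemma inH_integrable : mu.-integrable setT (EFin \o e).
Proof.
have [_ e2 _ ve] := eH; have [ii _] := indO_int L0.
apply: (le_integrableR _ _ (integrable_DR e2 ii)); first exact: me_.
move=> x; have [Ox|Ox] := pselect (Omega x); last first.
  by rewrite (ve _ Ox) normr0 addr_ge0 ?sqr_ge0 ?indO_ge0.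
rewrite indO1// -(real_normK (num_real (e x))).
have := sqr_ge0 (`|e x| - 1); have := normr_ge0 (e x); nra.
Qed.

Let ei1 : mu.-integrable setT (EFin \o (fun x => `|e x|)).
Proof. exact: integrable_norm inH_integrable. Qed.

Lemma L1norm_ge0 : 0 <= L1norm. Proof. by apply: Rintegral_ge0 => x _. Qed.

Lemma L1norm_sqr : L1norm ^+ 2 <= L * L2sq e.
Proof.
have [_ e2 _ ve] := eH; have [ii iE] := indO_int L0.
have h s : 2 * s * L1norm <= L2sq e + s ^+ 2 * L.
  rewrite -iE /L1norm /L2sq -!RintegralZl// -RintegralD//; last exact: integrable_ZR.
  apply: le_Rintegral => //; [exact: integrable_ZR|by apply: integrable_DR => //; exact: integrable_ZR|].
  move=> x _; have [Ox|Ox] := pselect (Omega x); last first.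
    rewrite (ve _ Ox) normr0 mulr0; apply: addr_ge0; first exact: sqr_ge0.
    by apply: mulr_ge0; [exact: sqr_ge0|exact: indO_ge0].
  rewrite indO1// -(real_normK (num_real (e x))).
  have := sqr_ge0 (`|e x| - s); lra.
(* The optimal s, the mean of |e| over Omega, turns the quadratic inequality into Cauchy-Schwarz. *)
have := h (L1norm / L).
have -> : 2 * (L1norm / L) * L1norm = 2 * (L1norm ^+ 2 / L) by field; rewrite gt_eqF.
have -> : (L1norm / L) ^+ 2 * L = L1norm ^+ 2 / L by field; rewrite gt_eqF.
move=> h1; have : L1norm ^+ 2 / L <= L2sq e by lra.
by rewrite ler_pdivrMr// mulrC.
Qed.

Let kei x : mu.-integrable setT (EFin \o (fun z => k (x - z) * e z)).
Proof.
have [_ _ kb _ _] := kA.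
apply: (le_integrableR _ _ (integrable_ZR A ei1)).
  apply: measurable_funM => //; apply: (measurableT_comp mk); exact: measurable_subl.
move=> z; have /andP[k0 k1] := kb (x - z).
by rewrite normrM (ger0_norm k0) ler_wpM2r.
Qed.

Lemma mollify_le x : `|mollify x| <= A * L1norm.
Proof.
have [_ _ kb _ _] := kA.
rewrite /L1norm -RintegralZl//; apply: norm_Rintegral_le => //; first exact: integrable_ZR.
move=> z; have /andP[k0 k1] := kb (x - z).
by rewrite normrM (ger0_norm k0) ler_wpM2r.
Qed.

Lemma mollify_lip x y : `|mollify x - mollify y| <= A * L1norm * `|x - y|.
Proof.
have [_ _ _ _ kl] := kA.
rewrite mulrAC /L1norm -RintegralZl// /mollify -RintegralB//.
apply: norm_Rintegral_le; [exact: integrable_BR|exact: integrable_ZR|].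
move=> z; rewrite -mulrBl normrM ler_wpM2r//.
by apply: (le_trans (kl _ _)); rewrite (_ : x - z - (y - z) = x - y)//; ring.
Qed.

(** The first summand is for the sup norm, the other for the seminorm of Y, through
    [mul_ellV_le]. *)
Definition mollify_cst : R := 1 + (1 + L * ellV (10^-1)).

(** Near 0, the inequality 1 + ln s <= s at s = 1/r, multiplied by r. *)
Lemma mul_ellV_le r : 0 < r -> r <= L -> r * ellV r <= 1 + L * ellV (10^-1).
Proof.
move=> r0 rL; have c0 : 0 <= ellV (10^-1 : R) by exact: normr_ge0.
have Lp := L0.
case: (leP r (10^-1)) => r1.
  rewrite ellV_small//; have q : 0 <= L * ellV (10^-1) by rewrite mulr_ge0// ltW.
  have := @ln1D_le _ (r^-1); rewrite invr_gt0 => /(_ r0).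
  rewrite lnV// => h; have : r * (1 - ln r) <= r * r^-1 by rewrite ler_wpM2l// ltW.
  rewrite divff ?gt_eqF// mulrBr mulr1 mulrN; lra.
apply: (@le_trans _ _ (L * ellV (10^-1))); last by rewrite lerDr.
apply: ler_pM => //; [exact: ltW|exact: normr_ge0|].
by apply: ellV_anti; rewrite ?invr_gt0// ltW.
Qed.

Lemma mollify_normY : (normY Omega mollify <= (mollify_cst * (A * L1norm))%:E)%E.
Proof.
have n0 := L1norm_ge0; have An : 0 <= A * L1norm by rewrite mulr_ge0// ltW.
have c0 : 0 <= ellV (10^-1 : R) by exact: normr_ge0.
rewrite /normY /mollify_cst mulrDl mul1r EFinD; apply: leeD.
- rewrite unlock /=; case: ifP => _; last by rewrite lee_fin.
  apply/ess_supP; apply: nearW => x /=; rewrite lee_fin patchE.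
  by case: ifP => _; rewrite ?normr0//; exact: mollify_le.
- apply: ge_ereal_sup => _ [[x y] /= [Ox Oy xy] <-]; rewrite lee_fin.
  have t0 : 0 < `|x - y| by rewrite normr_gt0 subr_eq0; exact/eqP.
  have tL : `|x - y| <= L.
    move: Ox Oy; rewrite /= !in_itv/= => /andP[? ?] /andP[? ?].
    by rewrite ler_norml; apply/andP; split; lra.
  have b0 : 0 < bdist2 Omega x y.
    rewrite lt_min; apply/andP; split.
      apply: lt_le_trans (bdist_ge L0 Ox); exact/OmegaP.
    apply: lt_le_trans (bdist_ge L0 Oy); exact/OmegaP.
  have e0 := ellp_gt0 2 b0; have e1 : ellp 2 (bdist2 Omega x y) <= 1 by exact: ellp_le1.
  have q0 : 0 <= `|mollify x - mollify y| / ell `|x - y|.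
    by rewrite mulr_ge0// invr_ge0 ltW// ell_gt0.
  (* The boundary weight is at most 1 and is dropped, the mollification being Lipschitz up to the
     boundary. *)
  apply: (@le_trans _ _ (`|mollify x - mollify y| / ell `|x - y|)); first by rewrite ler_piMl.
  rewrite ell_ellV invrK.
  apply: (@le_trans _ _ (A * L1norm * `|x - y| * ellV `|x - y|)).
    by rewrite ler_wpM2r ?normr_ge0//; exact: mollify_lip.
  rewrite -mulrA [leRHS]mulrC ler_wpM2l//; exact: mul_ellV_le.
Qed.

Let Fi : mu2.-integrable setT (EFin \o (fun p : R * R => k (p.1 - p.2) * (e p.1 * e p.2))).
Proof.
have [_ e2 _ ve] := eH; have [ki kN kb _ _] := kA.
have k0 t : 0 <= k t by have /andP[] := kb t.
have i1 := conv1_integrable e2 ki (fun x => sqr_ge0 (e x)) k0.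
have i2 := conv2_integrable e2 ki (fun x => sqr_ge0 (e x)) k0 kN.
have m1 : measurable_fun setT (fun p : R * R => k (p.1 - p.2)).
  by apply: (measurableT_comp mk); exact: measurable_sub12.
apply: (le_integrableR _ _ (integrable_DR i1 i2)).
  by have m := me_; mfun.
move=> p; rewrite normrM (ger0_norm (k0 _)) mulrC -mulrDl ler_wpM2r// normrM.
rewrite -(real_normK (num_real (e p.1))) -(real_normK (num_real (e p.2))).
have := sqr_ge0 (`|e p.1| - `|e p.2|); have := sqr_ge0 (`|e p.1| + `|e p.2|); nra.
Qed.

Lemma mollify_energy_le : (\int[mu]_x k x) * L2sq e <= energy e / 2 + \int[mu]_(x in Omega) (mollify x * e x).
Proof.
have [_ e2 eD ve] := eH; have [ki kN kb kk _] := kA.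
have k0 t : 0 <= k t by have /andP[] := kb t.
have i1 := conv1_integrable e2 ki (fun x => sqr_ge0 (e x)) k0.
have i2 := conv2_integrable e2 ki (fun x => sqr_ge0 (e x)) k0 kN.
have E1 := conv1E e2 ki (fun x => sqr_ge0 (e x)) k0.
have E2 := conv2E e2 ki (fun x => sqr_ge0 (e x)) k0 kN.
set Q := \int[mu]_x k x in E1 E2 *.
have EF : \int[mu2]_p (k (p.1 - p.2) * (e p.1 * e p.2)) = \int[mu]_(x in Omega) (mollify x * e x).
  have [_ <-] := iter_Rintegral Fi.
  rewrite [RHS]Rintegral_mkcond; apply: eq_Rintegral => x _ /=.
  transitivity (mollify x * e x).
    rewrite /mollify -RintegralZr//.
    by apply: eq_Rintegral => z _; ring.
  rewrite patchE; case: ifPn => // /negP hx.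
  by rewrite ve ?mulr0// => Ox; apply: hx; exact/mem_set.
have iB := integrable_BR (integrable_DR i1 i2) (integrable_ZR 2 Fi).
have : \int[mu2]_p (e p.1 ^+ 2 * k (p.1 - p.2) + e p.2 ^+ 2 * k (p.1 - p.2)
   - 2 * (k (p.1 - p.2) * (e p.1 * e p.2))) <= energy e.
  apply: le_Rintegral => // p _.
  (* On the diagonal the kernels are not comparable, but the integrand on the left vanishes. *)
  have [pe|ne] := eqVneq p.1 p.2.
    apply: (@le_trans _ _ 0); last by apply: mulr_ge0; [exact: nearker_ge0|exact: sqr_ge0].
    by rewrite pe [leLHS](_ : _ = 0) //; ring.
  rewrite [leLHS](_ : _ = k (p.1 - p.2) * (e p.1 - e p.2) ^+ 2); last by ring.
  rewrite ler_wpM2r ?sqr_ge0//; apply: kk.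
  by rewrite subr_eq0.
rewrite RintegralB//; [|exact: integrable_DR|exact: integrable_ZR].
rewrite RintegralD// RintegralZl// E1 E2 EF /L2sq.
lra.
Qed.

End Mollify.

(** * Duality and the error estimate *)

Section Final.
Context {R : realType}.
Local Notation mu := (@lebesgue_measure R).
Variables (L al : R).
Hypotheses (L0 : 0 < L) (al0 : 0 < al) (al1 : al < 1).
Local Notation Omega := (`]0, L[%classic : set R).

Lemma normY_ge0 (f : R -> R) : (0 <= normY Omega f)%E.
Proof.
have Lp := L0.
apply: adde_ge0; first exact: Lnorm_ge0.
apply: ereal_sup_ge => /=.
exists (ellp 2 (bdist2 Omega (L / 2) (L / 3)) *
  (`|f (L / 2) - f (L / 3)| / ell `|L / 2 - L / 3|))%:E; last first.
  rewrite lee_fin; apply: mulr_ge0; first exact: ellp_ge0.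
  by apply: mulr_ge0 => //; rewrite invr_ge0 ell_ellV invr_ge0 normr_ge0.
exists (L / 2, L / 3) => //=; rewrite !in_itv/=; split.
- apply/andP; split; lra.
- apply/andP; split; lra.
- move=> h; lra.
Qed.

Variable C0 : R.
Hypothesis C00 : 0 < C0.
Hypothesis alt : forall g : R -> R, spaceY Omega g ->
  exists w : R -> R,
    [/\ spaceX Omega al w, classical_solution Omega g w,
        (forall w' : R -> R, spaceX Omega al w' ->
           classical_solution Omega g w' -> w' = w)
      & (normX Omega al w <= C0%:E * normY Omega g)%E].

Let a1 : 1 < 1 + al. Proof. by rewrite ltrDl. Qed.
Let a2 : 1 + al <= 2. Proof. by have := al1; lra. Qed.

Lemma alternative_weak (g : R -> R) (G : R) : (normY Omega g <= G%:E)%E ->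
  exists2 w, Xbound L al (C0 * G) w &
    forall z, inH L z -> bform w z = \int[mu]_(x in Omega) (g x * z x).
Proof.
move=> gG; have [|w [[vw _] cw _ nw]] := alt (g := g).
  by apply: le_lt_trans gG _; exact: ltry.
have Xw : Xbound L al (C0 * G) w.
  apply: normX_Xbound => //; apply: (le_trans nw).
  by rewrite EFinM; apply: lee_wpmul2l => //; rewrite lee_fin ltW.
exists w => // z zH.
exact: (classical_weak L0 a1 a2 (Xbound_logreg al0 Xw) zH cw).
Qed.

Local Notation K := (L + `|rho1 R|).

Let K0 : 0 < K. Proof. by rewrite ltr_pwDl. Qed.

(* The dual problem is solved for the mollification of e: its right-hand side
   must lie in Y, and e itself does not. *)
Lemma duality : exists2 d : R, 0 < d & forall (N : nat) (e : R -> R),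
  L / N.+1%:R <= 10^-1 -> L / N.+1%:R < d -> inH L e ->
  (forall v, spaceV L N v -> bform e v = 0) ->
  K * L2sq e <= energy e / 8.
Proof.
have Kp := K0.
have [CI CI0 hinterp] := interpolation L0 al0 al1.
(* With t = 1 in [bform_bound] and the interpolation term at most [L2sq e], the estimate reads (13 K
   + 1) |e|^2 <= (3/2) E + (1 + K) |e|^2, where E is the energy of e. So 12 K |e|^2 <= (3/2) E. *)
have [|k [A [A0 kA kQ]]] := @mollifier_exists R (13 * K + 1); first by lra.
(* Collects every factor in front of [ellp al h * L2sq e] in [est2]; h is taken so small that
   [D * X <= 1]. *)
pose D := (1 + K) * CI * (C0 * (mollify_cst L * A)) ^+ 2 * L.
have D0 : 0 <= D.
  apply: mulr_ge0; last exact: ltW.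
  by apply: mulr_ge0; [apply: mulr_ge0 => //; lra|exact: sqr_ge0].
have [d d0 hd] := ellp_small al0 (divr_gt0 ltr01 (ltr_pwDr ltr01 D0)).
exists d => // N e h10 hsm eH orth.
set h := L / N.+1%:R in h10 hsm.
have h0 : 0 < h by rewrite divr_gt0.
have [w Xw weq] := alternative_weak (mollify_normY L0 A0 kA eH).
have [v Vv est] := hinterp N _ w h erefl h10 Xw.
have wH := Xbound_inH L0 al0 al1 Xw; have vH := spaceV_inH L0 al0 al1 Vv.
have pH := inH_sub wH vH.
have key := mollify_energy_le L0 kA eH; rewrite -(weq _ eH) in key.
(* By symmetry and Galerkin orthogonality the dual solution may be replaced by its interpolation
   error. *)
have Bphi : bform w e = bform (fun x => w x - v x) e.
  by rewrite (bform_subl L0 wH vH eH) (bform_sym L0 vH eH) orth// subr0.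
rewrite Bphi in key.
have bnd := bform_bound L0 pH eH ltr01; rewrite invr1 !mul1r in bnd.
have bnd' := le_trans (ler_norm _) bnd.
have n2 := L2sq_ge0 e; have nD := energy_ge0 e.
have p2 := L2sq_ge0 (fun x => w x - v x); have pD := energy_ge0 (fun x => w x - v x).
set X := ellp al h in est.
have X0 : 0 < X by exact: ellp_gt0.
have Dx : D * X <= 1.
  have : X < 1 / (D + 1) by exact: hd.
  rewrite ltr_pdivlMr; last by lra.
  nra.
have kN : (13 * K + 1) * L2sq e <= (\int[mu]_x k x) * L2sq e by rewrite ler_wpM2r.
set P := energy _ + L2sq _ in est.
have AP : energy (fun x => w x - v x) + K * L2sq (fun x => w x - v x) <= (1 + K) * P.
  rewrite /P; have : 0 <= K * energy (fun x => w x - v x) by rewrite mulr_ge0// ltW.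
  lra.
have est2 : (1 + K) * P <= L2sq e.
  apply: (@le_trans _ _ ((1 + K) * (CI * ((C0 * (mollify_cst L * (A * L1norm e))) ^+ 2 * X)))).
    by rewrite ler_wpM2l//; lra.
  rewrite [leLHS](_ : _ = (1 + K) * CI * (C0 * (mollify_cst L * A)) ^+ 2 * X * L1norm e ^+ 2); last by ring.
  apply: (@le_trans _ _ ((1 + K) * CI * (C0 * (mollify_cst L * A)) ^+ 2 * X * (L * L2sq e))).
    apply: ler_wpM2l; last exact: L1norm_sqr.
    apply: mulr_ge0; last exact: ltW.
    by apply: mulr_ge0; [apply: mulr_ge0 => //; lra|exact: sqr_ge0].
  rewrite [leLHS](_ : _ = D * X * L2sq e); last by rewrite /D; ring.
  by rewrite ler_piMl.
lra.
Qed.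

Lemma cea (f u : R -> R) (F : R) :
  (normY Omega f <= F%:E)%E -> weak_solution Omega f u ->
  exists h0 C : R, [/\ 0 < h0, 0 <= C & forall N uh,
    L / N.+1%:R < h0 -> fe_solution L N f uh ->
    inH L (fun x => u x - uh x) /\
    energy (fun x => u x - uh x) <= C * (F ^+ 2 * ellp al (L / N.+1%:R))].
Proof.
move=> fF [/spaceH_inH uH uweak].
have Kp := K0.
have [CI CI0 hinterp] := interpolation L0 al0 al1.
have [d d0 dual] := duality.
have [w Xw weq] := alternative_weak fF.
(* Neither witness depends on f or u. With P' the interpolation term and E the energy of e, E / 2 <=
   8 P' + E / 8 + E / 64 + E / 8, hence E <= (512 / 15) P' <= 40 P'. *)
exists (Num.min d (10^-1)), (40 * ((1 + K) * CI * C0 ^+ 2)); split.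
- by rewrite lt_min d0 /=; lra.
- by apply: mulr_ge0 => //; apply: mulr_ge0; [apply: mulr_ge0 => //; lra|exact: sqr_ge0].
move=> N uh; set h := L / N.+1%:R; rewrite lt_min => /andP[hd /ltW h10] [Vuh uheq].
have uhH := spaceV_inH L0 al0 al1 Vuh.
have eH := inH_sub uH uhH; split => //.
set e := fun x => _ in eH *.
have orth v : spaceV L N v -> bform e v = 0.
  move=> Vv; have vH := spaceV_inH L0 al0 al1 Vv.
  rewrite (bform_subl L0 uH uhH vH) -(EL_bform uH vH) -(EL_bform uhH vH) uheq// uweak ?subrr//.
  exact/spaceH_inH.
have [v Vv est] := hinterp N _ w h erefl h10 Xw.
have wH := Xbound_inH L0 al0 al1 Xw; have vH := spaceV_inH L0 al0 al1 Vv.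
have pH := inH_sub wH vH.
have N2e := dual N e h10 hd eH orth.
(* Orthogonality removes [uh] on one side and inserts v on the other; in between, u is exchanged for
   w because both produce the integral of f e. *)
have Bee : bform e e = bform (fun x => w x - v x) e.
  rewrite {2}/e (bform_subr L0 uH uhH eH) (orth _ Vuh) subr0.
  rewrite (bform_sym L0 eH uH) (bform_subl L0 wH vH eH) (bform_sym L0 vH eH) (orth _ Vv) subr0.
  rewrite weq// -(EL_bform uH eH) uweak//.
  exact/spaceH_inH.
have t0 : 0 < 8^-1 :> R by rewrite invr_gt0.
have bnd := le_trans (ler_norm _) (bform_bound L0 pH eH t0); rewrite invrK in bnd.
have coer := bform_coercive L0 eH; rewrite Bee in coer.
have nD := energy_ge0 e.
have p2 := L2sq_ge0 (fun x => w x - v x); have pD := energy_ge0 (fun x => w x - v x).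
set P := energy _ + L2sq _ in est.
have AP : energy (fun x => w x - v x) + K * L2sq (fun x => w x - v x) <= (1 + K) * P.
  rewrite /P; have : 0 <= K * energy (fun x => w x - v x) by rewrite mulr_ge0// ltW.
  lra.
have fin : (1 + K) * P <= (1 + K) * (CI * ((C0 * F) ^+ 2 * ellp al h)).
  by rewrite ler_wpM2l//; lra.
apply: (@le_trans _ _ (40 * ((1 + K) * P))); first by lra.
rewrite [leRHS](_ : _ = 40 * ((1 + K) * (CI * ((C0 * F) ^+ 2 * ellp al h)))); last by ring.
by rewrite ler_wpM2l.
Qed.

End Final.

Theorem theorem1p2 (R : realType) (L : R) (f u : R -> R) (alpha : R) :
  let Omega : set R := `]0, L[%classic in
  0 < L ->
  spaceY Omega f ->
  0 < alpha < 1 ->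
  (exists2 C0 : R, 0 < C0 &
    forall g : R -> R, spaceY Omega g ->
      exists w : R -> R,
        [/\ spaceX Omega alpha w, classical_solution Omega g w,
            (forall w' : R -> R, spaceX Omega alpha w' ->
               classical_solution Omega g w' -> w' = w)
          & (normX Omega alpha w <= C0%:E * normY Omega g)%E]) ->
  weak_solution Omega f u ->
  exists h0 C beta : R,
    [/\ 0 < h0, 0 < C, 0 < beta < 1
    & forall N : nat, (1 <= N)%N ->
        let h := L / N.+1%:R in
        h < h0 ->
        forall uh : R -> R, fe_solution L N f uh ->
          (normH (fun x => (u x - uh x)%R) <=
             (C * ellp beta h)%:E * normY Omega f)%E].
Proof.
move=> Omega L0 fY /andP[al0 al1] [C0 C00 alt] uweak.
have nf := normY_ge0 L0 f.
have fE : normY Omega f = (fine (normY Omega f))%:E by rewrite fineK// ge0_fin_numE.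
set F := fine _ in fE.
have F0 : 0 <= F by rewrite -lee_fin -fE.
have fF : (normY Omega f <= F%:E)%E by rewrite fE.
have [h0 [C [h00 Cge0 est]]] := cea L0 al0 al1 C00 alt fF uweak.
(* The estimate of the squared norm carries ell^alpha(h), so the root halves the exponent; the added
   1 makes the constant positive. *)
exists h0, (Num.sqrt C + 1), (alpha / 2); split => //.
  by apply/andP; split; lra.
move=> N _ h hh0 uh fe; have [eH le] := est N uh hh0 fe.
rewrite (normH_energy eH) fE -EFinM lee_fin.
have hp : 0 < h by rewrite divr_gt0.
have l0 : 0 <= ellp (alpha / 2) h by exact: ellp_ge0.
have lE : ellp alpha h = ellp (alpha / 2) h ^+ 2.
  by rewrite /ellp -powR_mulrn ?powR_ge0// -powRrM divfK// pnatr_eq0.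
rewrite -/h lE in le.
apply: (@le_trans _ _ (Num.sqrt (C * (F * ellp (alpha / 2) h) ^+ 2))).
  by apply: ler_wsqrtr; rewrite exprMn.
rewrite sqrtrM// sqrtr_sqr ger0_norm ?mulr_ge0//.
rewrite mulrCA mulrC -mulrA [leRHS](_ : _ = (Num.sqrt C + 1) * (F * ellp (alpha / 2) h)); last by ring.
rewrite [leLHS](_ : _ = Num.sqrt C * (F * ellp (alpha / 2) h)); last by ring.
by rewrite ler_wpM2r ?mulr_ge0// lerDl.
Qed.
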